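(* On a Riemannian manifold $(M,g)$ endowed with a unit vector field $N$, if the metric evolves by the Partial Ricci Flow $\partial_t g=-2\,r(g)$, then the curvature tensor $R_{ijkl}$ $(i,j,k,l\ge0)$ in adapted coordinates evolves according to a heat type equation along $N$-curves: $$\partial_t R_{ijkl}=\nabla^2_{N,N}R_{ijkl}+B_{ijkl}-B_{ijlk}-B_{jikl}+B_{jilk}-2B_{kjli}+2B_{kilj}-g^{pq}\big(R_{qjkl}\,r_{ip}+R_{iqkl}\,r_{jp}+R_{ijql}\,r_{kp}+R_{ijkq}\,r_{lp}\big)-\tilde Q,$$ where $\tilde Q=Q_{ik;jl}-Q_{il;jk}-Q_{jk;il}+Q_{jl;ik}$.
   Context: Curvature conventions: $R(X,Y)=\nabla_Y\nabla_X-\nabla_X\nabla_Y+\nabla_{[X,Y]}$, $R(X,Y,Z,V)=g(R(X,Y)Z,V)$; second covariant derivative $\nabla^2_{X,Y}=\nabla_X\nabla_Y-\nabla_{\nabla_XY}$. The partial Ricci curvature is $r(X,Y)=R(X,N,Y,N)$ for $X,Y\in TM$. Adapted coordinates are local (time-independent) coordinates $(x_0,x_1,\dots,x_n)$ with coordinate fields $\partial_i$ such that $\partial_0=N$ and $g_{00}=1$. All components are in adapted coordinates, repeated indices $p,q$ are summed over $0,\dots,n$, $R_{ijkl}=R(\partial_i,\partial_j,\partial_k,\partial_l)$, $r_{ij}=r(\partial_i,\partial_j)=R_{i0j0}$, and derivatives are derivatives of tensors, e.g. $\nabla^2_{i,k}R_{j0l0}=(\nabla^2_{\partial_i,\partial_k}R)(\partial_j,\partial_0,\partial_l,\partial_0)$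 and $\nabla^2_{i,k}r_{jl}=(\nabla^2_{\partial_i,\partial_k}r)(\partial_j,\partial_l)$. The quadratic curvature tensor is $B_{ijkl}=g^{pq}R_{pij0}R_{qkl0}$. The quantities $Q$ are $Q_{ik;jl}:=\nabla^2_{i,k}R_{j0l0}-\nabla^2_{i,k}r_{jl}$; they involve only first order spatial derivatives of the curvature: with the co-nullity tensor $C(X)=-\nabla_XN$, $$\begin{aligned}Q_{ik;jl}={}&(\nabla_iR)(\partial_j,C\partial_k,\partial_l,\partial_0)+(\nabla_iR)(\partial_j,\partial_0,\partial_l,C\partial_k)+(\nabla_kR)(\partial_j,C\partial_i,\partial_l,\partial_0)+(\nabla_kR)(\partial_j,\partial_0,\partial_l,C\partial_i)\\&+R(\partial_j,(\nabla_iC)\partial_k,\partial_l,\partial_0)+R(\partial_j,\partial_0,\partial_l,(\nabla_iC)\partial_k)-R(\partial_j,C\partial_k,\partial_l,C\partial_i)-R(\partial_j,C\partial_i,\partial_l,C\partial_k).\end{aligned}$$ *)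

(* Defs.v *)
From HB Require Import structures.
From mathcomp Require Import all_boot all_order all_algebra.
From mathcomp Require Import all_classical all_reals all_analysis.

Set Implicit Arguments.
Unset Strict Implicit.
Unset Printing Implicit Defensive.

Import Order.TTheory GRing.Theory Num.Theory.
Import numFieldNormedType.Exports.

Local Open Scope classical_set_scope.
Local Open Scope ring_scope.

Section Smooth.
Context {R : realType} {V W : normedModType R}.

(* [U] is meant to be open and [V] finite-dimensional. *)
Fixpoint Ck (k : nat) (U : set V) (f : V -> W) : Prop :=
  (forall x, U x -> {for x, continuous f}) /\
  match k with
  | 0%N => True
  | k'.+1 => forall v, (forall x, U x -> derivable f x v) /\
                       Ck k' U (fun x => 'D_v f x)
  end.

Definition smooth_on (U : set V) (f : V -> W) : Prop := forall k, Ck k U f.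

End Smooth.

(* The values of [chart_map] off [dom] and of [chart_inv] off [img] are
   irrelevant. *)
Record chart (R : realType) (m : nat) (M : topologicalType) := Chart {
  dom : set M;
  img : set 'rV[R]_m;
  chart_map : M -> 'rV[R]_m;
  chart_inv : 'rV[R]_m -> M;
  dom_open : open dom;
  img_open : open img;
  chart_map_img : forall p, dom p -> img (chart_map p);
  chart_inv_dom : forall x, img x -> dom (chart_inv x);
  chart_mapK : forall p, dom p -> chart_inv (chart_map p) = p;
  chart_invK : forall x, img x -> chart_map (chart_inv x) = x;
  chart_map_cont : forall p, dom p -> {for p, continuous chart_map};
  chart_inv_cont : forall x, img x -> {for x, continuous chart_inv}
}.

Section Charts.
Context {R : realType} {m : nat} {M : topologicalType}.
Implicit Types c d : chart R m M.

Definition overlap c d : set 'rV[R]_m := img c `&` chart_inv c @^-1` dom d.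

Definition transition c d : 'rV[R]_m -> 'rV[R]_m := chart_map d \o chart_inv c.

Definition compatible c d : Prop :=
  smooth_on (overlap c d) (transition c d) /\
  smooth_on (overlap d c) (transition d c).

End Charts.

(* The atlas is maximal, so that "a chart in the atlas" means an arbitrary
   local coordinate system of the manifold. *)
Structure smooth_manifold (R : realType) (m : nat) := SmoothManifold {
  points :> topologicalType;
  points_hausdorff : hausdorff_space points;
  points_second_countable : @second_countable points;
  atlas : set (chart R m points);
  atlas_cover : forall p, exists2 c, atlas c & dom c p;
  atlas_compatible : forall c d, atlas c -> atlas d -> compatible c d;
  atlas_maximal : forall c, (forall d, atlas d -> compatible c d) -> atlas c
}.

(* Tensor fields on a manifold are given by their components in every chart,
   subject to the transformation law. Tangent vectors are row vectors, so that
   ['J phi x i j] is the derivative of the [j]-th component of [phi] in the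
   [i]-th direction, and vectors are pushed forward by [v |-> v *m 'J phi x]. *)
Section Fields.
Context {R : realType} {m : nat} (M : smooth_manifold R m).

Definition vector_components := chart R m M -> 'rV[R]_m -> 'rV[R]_m.
Definition metric_components := chart R m M -> 'rV[R]_m -> 'M[R]_m.

Definition is_vector_field (X : vector_components) : Prop :=
  (forall c, atlas c -> smooth_on (img c) (X c)) /\
  (forall c d x, atlas c -> atlas d -> overlap c d x ->
     X d (transition c d x) = X c x *m 'J (transition c d) x).

Definition is_riemannian_metric (g : metric_components) : Prop :=
  [/\ forall c, atlas c -> smooth_on (img c) (g c),
      forall c x, atlas c -> img c x -> (g c x)^T = g c x,
      forall c x, atlas c -> img c x ->
        forall v : 'rV[R]_m, v != 0 -> 0 < (v *m g c x *m v^T) 0 0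
    & forall c d x, atlas c -> atlas d -> overlap c d x ->
        g c x = 'J (transition c d) x *m g d (transition c d x)
                  *m ('J (transition c d) x)^T].

Definition is_metric_evolution (J : set R) (g : R -> metric_components) : Prop :=
  (forall t, J t -> is_riemannian_metric (g t)) /\
  (forall c, atlas c ->
     smooth_on (J `*` img c) (fun tx : R * 'rV[R]_m => g tx.1 c tx.2)).

Definition is_unit_for (g : metric_components) (X : vector_components) : Prop :=
  forall c x, atlas c -> img c x -> (X c x *m g c x *m (X c x)^T) 0 0 = 1.

End Fields.

(* Riemannian geometry in a coordinate domain: [G] is the matrix of components
   of the metric, and covariant tensor fields are functions of vector fields. *)
Section Coordinates.
Context {R : realType} {m : nat}.

Definition vfield := 'rV[R]_m -> 'rV[R]_m.
Definition tensor2 := vfield -> vfield -> 'rV[R]_m -> R.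
Definition tensor4 := vfield -> vfield -> vfield -> vfield -> 'rV[R]_m -> R.

Definition coord_field (i : 'I_m) : vfield := fun=> delta_mx 0 i.

Definition deriv_along (X : vfield) (f : 'rV[R]_m -> R) : 'rV[R]_m -> R :=
  fun x => 'D_(X x) f x.

Definition lie_bracket (X Y : vfield) : vfield := fun x =>
  \row_k (deriv_along X (fun y => Y y 0 k) x -
          deriv_along Y (fun y => X y 0 k) x).

Variable G : 'rV[R]_m -> 'M[R]_m.

Definition inner (X Y : vfield) : 'rV[R]_m -> R :=
  fun x => (X x *m G x *m (Y x)^T) 0 0.

Definition christoffel (k i j : 'I_m) : 'rV[R]_m -> R := fun x =>
  2^-1 * \sum_l invmx (G x) k l *
    (deriv_along (coord_field i) (fun y => G y j l) x +
     deriv_along (coord_field j) (fun y => G y i l) x -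
     deriv_along (coord_field l) (fun y => G y i j) x).

Definition nabla (X Y : vfield) : vfield := fun x =>
  \row_k (deriv_along X (fun y => Y y 0 k) x +
          \sum_i \sum_j christoffel k i j x * X x 0 i * Y x 0 j).

(* This is the opposite of the more common sign convention; the sectional
   curvature of an orthonormal pair is then [curv X Y X Y]. *)
Definition curv_op (X Y Z : vfield) : vfield := fun x =>
  nabla Y (nabla X Z) x - nabla X (nabla Y Z) x + nabla (lie_bracket X Y) Z x.

Definition curv : tensor4 := fun X Y Z W => inner (curv_op X Y Z) W.

Definition partial_ricci (N : vfield) : tensor2 := fun X Y => curv X N Y N.

Definition nabla_tensor2 (X : vfield) (T : tensor2) : tensor2 := fun Y Z x =>
  deriv_along X (T Y Z) x - T (nabla X Y) Z x - T Y (nabla X Z) x.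

Definition nabla_tensor4 (X : vfield) (T : tensor4) : tensor4 :=
  fun Y Z U W x =>
    deriv_along X (T Y Z U W) x - T (nabla X Y) Z U W x - T Y (nabla X Z) U W x
      - T Y Z (nabla X U) W x - T Y Z U (nabla X W) x.

Definition nabla2_tensor2 (X Y : vfield) (T : tensor2) : tensor2 :=
  fun Z U x => nabla_tensor2 X (nabla_tensor2 Y T) Z U x
                 - nabla_tensor2 (nabla X Y) T Z U x.

Definition nabla2_tensor4 (X Y : vfield) (T : tensor4) : tensor4 :=
  fun Z U W S x => nabla_tensor4 X (nabla_tensor4 Y T) Z U W S x
                     - nabla_tensor4 (nabla X Y) T Z U W S x.

Definition components2 (T : tensor2) (i j : 'I_m) : 'rV[R]_m -> R :=
  T (coord_field i) (coord_field j).

Definition components4 (T : tensor4) (i j k l : 'I_m) : 'rV[R]_m -> R :=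
  T (coord_field i) (coord_field j) (coord_field k) (coord_field l).

End Coordinates.

Section AdaptedComponents.
Context {R : realType} {n : nat}.
Variables (G : 'rV[R]_n.+1 -> 'M[R]_n.+1) (N : @vfield R n.+1).

Definition quad_curv (i j k l : 'I_n.+1) (x : 'rV[R]_n.+1) : R :=
  \sum_p \sum_q invmx (G x) p q *
    components4 (curv G) p i j ord0 x * components4 (curv G) q k l ord0 x.

(* [hess_defect i k j l] is $Q_{ik;jl}$. *)
Definition hess_defect (i k j l : 'I_n.+1) (x : 'rV[R]_n.+1) : R :=
  components4 (nabla2_tensor4 G (coord_field i) (coord_field k) (curv G))
        j ord0 l ord0 x
  - components2 (nabla2_tensor2 G (coord_field i) (coord_field k)
             (partial_ricci G N)) j l x.

End AdaptedComponents.

Section Flow.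
Context {R : realType}.

Definition is_partial_ricci_flow {m : nat} (M : smooth_manifold R m)
    (N : vector_components M) (J : set R) (g : R -> metric_components M) : Prop :=
  forall t c x i j, J t -> atlas c -> img c x ->
    is_derive t 1 (fun s => g s c x i j)
      (- 2 * components2 (partial_ricci (g t c) (N c)) i j x).

Definition is_adapted {n : nat} (M : smooth_manifold R n.+1)
    (N : vector_components M) (J : set R) (g : R -> metric_components M)
    (c : chart R n.+1 M) : Prop :=
  [/\ atlas c,
      forall x, img c x -> N c x = coord_field ord0 x
    & forall t x, J t -> img c x -> g t c x ord0 ord0 = 1].

End Flow.

(* Main.v *)
Require Import Defs.
From HB Require Import structures.
From mathcomp Require Import all_boot all_order all_algebra.
From mathcomp Require Import all_classical all_reals all_analysis.
From mathcomp Require Import ring lra.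

Set Implicit Arguments.
Unset Strict Implicit.
Unset Printing Implicit Defensive.

Import Order.TTheory GRing.Theory Num.Theory.
Import numFieldNormedType.Exports.

Local Open Scope classical_set_scope.
Local Open Scope ring_scope.

(* The variation of the curvature under [dt g = -2 r] is a combination of second
   covariant derivatives of [r] plus curvature terms; trading the Hessian of [r]
   for that of the curvature produces the terms [Q], and the second Bianchi
   identity (twice) with the Ricci identity turns the remaining four Hessians
   into the second derivative along [N] plus quadratic terms.
   All of this is algebra of commuting derivations: it is carried out for row
   vectors over a commutative ring, by evaluating tensors on coordinate fields
   and extending by multilinearity, and is then applied to the ring of smooth
   functions of time and position on [J `*` img c], whose coordinate
   derivations commute by Schwarz's theorem. *)

(** * Derivations and connections over a commutative ring *)

(** Time is a variable of the ring because the flow equation then becomes an identity between ring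
    elements, which can be differentiated in space. The variation of the Christoffel symbols comes
    from differentiating metric compatibility in time, not from their explicit formula. In the
    algebra $N$ is just a coordinate field [e o], and $r$ is $R$ with two slots filled by it. Since
    [e o] need not be parallel, the Hessians of $r$ and $R$ differ, and $Q$ is exactly that
    difference. The four $r$-terms have two origins: those with $r_{ip}$, $r_{jp}$ come from
    commuting derivatives in $\nabla^2_{i,0}R$ and $\nabla^2_{j,0}R$; those with $r_{kp}$, $r_{lp}$
    come from the variation of $R$, where the Ricci identity for $r$ absorbs half of the factor
    $-2$. The transfer to functions meets one obstacle: [Ck] speaks of directional derivatives only,
    while derivatives along arbitrary fields must be linear in the direction. This linearity and the
    symmetry of second derivatives both come from the mean value theorem on small parallelograms. *)

Definition derivation (A : pzRingType) (d : A -> A) : Prop :=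
  (forall a b, d (a + b) = d a + d b) /\
  (forall a b, d (a * b) = d a * b + a * d b).

Section Derivation.
Context {A : pzRingType} {d : A -> A} (dP : derivation d).

Lemma derivation0 : d 0 = 0.
Proof. by apply: (addrI (d 0)); rewrite -dP.1 !addr0. Qed.

Lemma derivationN a : d (- a) = - d a.
Proof. by apply: (addrI (d a)); rewrite -dP.1 !subrr derivation0. Qed.

Lemma derivationB a b : d (a - b) = d a - d b.
Proof. by rewrite dP.1 derivationN. Qed.

Lemma derivation1 : d 1 = 0.
Proof.
by apply: (addrI (d 1)); rewrite addr0 -[in RHS](mulr1 1) dP.2 mulr1 mul1r.
Qed.

Lemma derivation_sum (I : Type) (r : seq I) (P : pred I) (F : I -> A) :
  d (\sum_(i <- r | P i) F i) = \sum_(i <- r | P i) d (F i).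
Proof. exact: (big_morph d dP.1 derivation0). Qed.

Lemma derivation_mxB p q (X Y : 'M[A]_(p, q)) :
  map_mx d (X - Y) = map_mx d X - map_mx d Y.
Proof. by apply/matrixP => i j; rewrite !mxE derivationB. Qed.

Lemma derivation_mulmx p q r (X : 'M[A]_(p, q)) (Y : 'M[A]_(q, r)) :
  map_mx d (X *m Y) = map_mx d X *m Y + X *m map_mx d Y.
Proof.
apply/matrixP => i j; rewrite !mxE derivation_sum -big_split /=.
by apply: eq_bigr => k _; rewrite dP.2 !mxE.
Qed.

End Derivation.

Section Linear.
Context {A : comNzRingType} {m : nat}.
Implicit Types (F : 'rV[A]_m -> A) (X Y Z W : 'rV[A]_m).

Definition linear_form F : Prop :=
  forall a X Y, F (a *: X + Y) = a * F X + F Y.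

Section Theory.
Context {F : 'rV[A]_m -> A} (F_lin : linear_form F).

Lemma linear_formD X Y : F (X + Y) = F X + F Y.
Proof. by have := F_lin 1 X Y; rewrite scale1r mul1r. Qed.

Lemma linear_form0 : F 0 = 0.
Proof. by apply: (addrI (F 0)); rewrite -linear_formD !addr0. Qed.

Lemma linear_formZ a X : F (a *: X) = a * F X.
Proof. by have := F_lin a X 0; rewrite !addr0 linear_form0 addr0. Qed.

Lemma linear_formB X Y : F (X - Y) = F X - F Y.
Proof. by rewrite linear_formD -scaleN1r linear_formZ mulN1r. Qed.

Lemma linear_form_sum (I : Type) (r : seq I) (P : pred I) (X : I -> 'rV[A]_m) :
  F (\sum_(i <- r | P i) X i) = \sum_(i <- r | P i) F (X i).
Proof. exact: (big_morph F linear_formD linear_form0). Qed.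

Lemma linear_form_expand X : F X = \sum_i X 0 i * F (delta_mx 0 i).
Proof.
rewrite {1}[X]row_sum_delta linear_form_sum.
by apply: eq_bigr => i _; rewrite linear_formZ.
Qed.

End Theory.

(** Tensor identities are reduced to coordinate fields by this lemma, one slot at a time. On
    coordinate fields brackets vanish and a torsion-free connection is symmetric. *)
Lemma linear_form_eq F F' : linear_form F -> linear_form F' ->
  (forall i, F (delta_mx 0 i) = F' (delta_mx 0 i)) -> forall X, F X = F' X.
Proof.
move=> FL FL' FF X; rewrite (linear_form_expand FL) (linear_form_expand FL').
by apply: eq_bigr => i _; rewrite FF.
Qed.

Definition bilinear_form (T : 'rV[A]_m -> 'rV[A]_m -> A) : Prop :=
  (forall Y, linear_form (T^~ Y)) /\ (forall X, linear_form (T X)).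

Definition quadrilinear_form
    (T : 'rV[A]_m -> 'rV[A]_m -> 'rV[A]_m -> 'rV[A]_m -> A) : Prop :=
  [/\ forall Y Z W, linear_form (fun X => T X Y Z W),
      forall X Z W, linear_form (fun Y => T X Y Z W),
      forall X Y W, linear_form (fun Z => T X Y Z W)
    & forall X Y Z, linear_form (T X Y Z)].

Lemma quadrilinear_form_eq T T' : quadrilinear_form T -> quadrilinear_form T' ->
  (forall i j k l : 'I_m,
     T (delta_mx 0 i) (delta_mx 0 j) (delta_mx 0 k) (delta_mx 0 l) =
     T' (delta_mx 0 i) (delta_mx 0 j) (delta_mx 0 k) (delta_mx 0 l)) ->
  forall X Y Z W, T X Y Z W = T' X Y Z W.
Proof.
move=> [T1 T2 T3 T4] [T1' T2' T3' T4'] TT X Y Z W.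
apply: (linear_form_eq (T1 Y Z W) (T1' Y Z W)) => i.
apply: (linear_form_eq (T2 _ Z W) (T2' _ Z W)) => j.
apply: (linear_form_eq (T3 _ _ W) (T3' _ _ W)) => k.
by apply: (linear_form_eq (T4 _ _ _) (T4' _ _ _)) => l.
Qed.

End Linear.

Section Connection.
Context {A : comNzRingType} {m : nat}.
Implicit Types (f a : A) (X Y Z W : 'rV[A]_m).

Context (d : 'I_m -> A -> A).

Definition der_along X f : A := \sum_i X 0 i * d i f.

Definition bracket X Y : 'rV[A]_m :=
  \row_k (der_along X (Y 0 k) - der_along Y (X 0 k)).

Context (Gam : 'I_m -> 'I_m -> 'I_m -> A).

(** The symbols [Gam] are arbitrary here: multilinearity of the curvature and the Ricci identity are
    facts about affine connections, and the metric enters only later. *)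
Definition conn X Y : 'rV[A]_m :=
  \row_k (der_along X (Y 0 k) + \sum_i \sum_j Gam k i j * X 0 i * Y 0 j).

Definition conn_curv X Y Z : 'rV[A]_m :=
  conn Y (conn X Z) - conn X (conn Y Z) + conn (bracket X Y) Z.

Definition conn2 X (T : 'rV[A]_m -> 'rV[A]_m -> A) Y Z : A :=
  der_along X (T Y Z) - T (conn X Y) Z - T Y (conn X Z).

Definition conn4 X (T : 'rV[A]_m -> 'rV[A]_m -> 'rV[A]_m -> 'rV[A]_m -> A)
    Y Z U W : A :=
  der_along X (T Y Z U W) - T (conn X Y) Z U W - T Y (conn X Z) U W
  - T Y Z (conn X U) W - T Y Z U (conn X W).

Definition hess2 X Y (T : 'rV[A]_m -> 'rV[A]_m -> A) Z U : A :=
  conn2 X (conn2 Y T) Z U - conn2 (conn X Y) T Z U.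

Definition hess4 X Y (T : 'rV[A]_m -> 'rV[A]_m -> 'rV[A]_m -> 'rV[A]_m -> A)
    Z U W S : A :=
  conn4 X (conn4 Y T) Z U W S - conn4 (conn X Y) T Z U W S.

Context (dP : forall i, derivation (d i)).
Context (dC : forall i j a, d i (d j a) = d j (d i a)).

Local Notation e i := (@delta_mx A 1 m 0 i).

Lemma der_alongD X f g : der_along X (f + g) = der_along X f + der_along X g.
Proof.
rewrite /der_along -big_split /=; apply: eq_bigr => i _.
by rewrite (dP i).1 mulrDr.
Qed.

Lemma der_alongM X f g :
  der_along X (f * g) = der_along X f * g + f * der_along X g.
Proof.
rewrite /der_along mulr_suml mulr_sumr -big_split /=; apply: eq_bigr => i _.
by rewrite (dP i).2; ring.
Qed.

Lemma der_along_derivation X : derivation (der_along X).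
Proof. by split; [exact: der_alongD|exact: der_alongM]. Qed.

Lemma der_along_linear f : linear_form (der_along^~ f).
Proof.
move=> a X Y; rewrite /der_along mulr_sumr -big_split /=.
by apply: eq_bigr => i _; rewrite !mxE; ring.
Qed.

Lemma sum_delta (i : 'I_m) (F : 'I_m -> A) : \sum_j (e i) 0 j * F j = F i.
Proof.
rewrite (bigD1 i) //= big1 ?addr0 => [|j ji]; rewrite !mxE !eqxx /=.
  by rewrite mul1r.
by rewrite (negbTE ji) mul0r.
Qed.

Lemma der_along_coord i f : der_along (e i) f = d i f.
Proof. exact: sum_delta. Qed.

Lemma conn_linear a X Y Z : conn (a *: X + Y) Z = a *: conn X Z + conn Y Z.
Proof.
apply/rowP => k; rewrite !mxE der_along_linear mulrDr.
rewrite addrACA; congr (_ + _ + _); rewrite mulr_sumr -big_split /=.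
apply: eq_bigr => i _; rewrite mulr_sumr -big_split /=.
by apply: eq_bigr => j _; rewrite !mxE; ring.
Qed.

Lemma connD X Y Z : conn X (Y + Z) = conn X Y + conn X Z.
Proof.
apply/rowP => k; rewrite !mxE der_alongD addrACA; congr (_ + _).
rewrite -big_split /=; apply: eq_bigr => i _; rewrite -big_split /=.
by apply: eq_bigr => j _; rewrite !mxE; ring.
Qed.

Lemma connZ X a Y : conn X (a *: Y) = der_along X a *: Y + a *: conn X Y.
Proof.
apply/rowP => k; rewrite !mxE der_alongM mulrDr -addrA; congr (_ + (_ + _)).
rewrite mulr_sumr; apply: eq_bigr => i _; rewrite mulr_sumr.
by apply: eq_bigr => j _; rewrite !mxE; ring.
Qed.

Lemma conn0 X : conn X 0 = 0.
Proof. by apply: (addrI (conn X 0)); rewrite -connD !addr0. Qed.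

Lemma connN X Y : conn X (- Y) = - conn X Y.
Proof. by apply: (addrI (conn X Y)); rewrite -connD !subrr conn0. Qed.

Lemma connB X Y Z : conn X (Y - Z) = conn X Y - conn X Z.
Proof. by rewrite connD connN. Qed.

Lemma conn0l Y : conn 0 Y = 0.
Proof.
apply: (addrI (conn 0 Y)); rewrite -[in X in X + _](scale1r (conn 0 Y)).
by rewrite -conn_linear scale1r !addr0.
Qed.

Lemma connDl X Y Z : conn (X + Y) Z = conn X Z + conn Y Z.
Proof. by rewrite -[X]scale1r conn_linear !scale1r. Qed.

Lemma connZl a X Y : conn (a *: X) Y = a *: conn X Y.
Proof. by rewrite -[a *: X]addr0 conn_linear conn0l !addr0. Qed.

Lemma connNl X Y : conn (- X) Y = - conn X Y.
Proof. by rewrite -!scaleN1r connZl. Qed.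

(** Each composition splits into a first-order part and a second-order part; the second-order parts
    agree because the [d i] commute. *)
Lemma der_along_bracket X Y f :
  der_along (bracket X Y) f =
  der_along X (der_along Y f) - der_along Y (der_along X f).
Proof.
rewrite {1}/der_along.
under eq_bigr do rewrite mxE mulrBl.
rewrite big_split /= sumrN.
have E U V : der_along U (der_along V f) =
    \sum_i der_along U (V 0 i) * d i f
    + \sum_i \sum_j U 0 i * V 0 j * d i (d j f).
  rewrite {2}/der_along (derivation_sum (der_along_derivation U)).
  under eq_bigr do rewrite der_alongM.
  rewrite big_split /=; congr (_ + _).
  under eq_bigr do rewrite /der_along mulr_sumr.
  rewrite exchange_big /=; apply: eq_bigr => i _; apply: eq_bigr => j _.
  by ring.
rewrite !E.
suff -> : \sum_i \sum_j X 0 i * Y 0 j * d i (d j f) =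
          \sum_i \sum_j Y 0 i * X 0 j * d i (d j f) by ring.
rewrite exchange_big /=; apply: eq_bigr => i _; apply: eq_bigr => j _.
by rewrite dC; ring.
Qed.

Lemma bracketC X Y : bracket Y X = - bracket X Y.
Proof. by apply/rowP => k; rewrite !mxE opprB. Qed.

Lemma bracket_linear a X Y Z :
  bracket (a *: X + Y) Z = a *: bracket X Z - der_along Z a *: X + bracket Y Z.
Proof.
apply/rowP => k; rewrite !mxE der_along_linear der_alongD der_alongM.
by ring.
Qed.

Lemma bracket_coord i j : bracket (e i) (e j) = 0.
Proof.
apply/rowP => k; rewrite !mxE !der_along_coord !eqxx /=.
by case: eqP => _; case: eqP => _;
   rewrite ?(derivation0 (dP _)) ?(derivation1 (dP _)) subrr.
Qed.

Lemma conn_curvC X Y Z : conn_curv Y X Z = - conn_curv X Y Z.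
Proof. by rewrite /conn_curv bracketC connNl !opprD opprK [_ + - conn Y _]addrC. Qed.

(** The Leibniz term [der_along Z a *: conn X W] is cancelled by the non-tensorial term of
    [bracket_linear]. *)
Lemma conn_curv_linear1 a X Y Z W :
  conn_curv (a *: X + Y) Z W = a *: conn_curv X Z W + conn_curv Y Z W.
Proof.
rewrite /conn_curv bracket_linear !(connDl, connD, connNl, connZl, connZ).
by apply/rowP => k; rewrite !mxE; ring.
Qed.

Lemma conn_curv_linear2 a X Y Z W :
  conn_curv Z (a *: X + Y) W = a *: conn_curv Z X W + conn_curv Z Y W.
Proof.
rewrite conn_curvC conn_curv_linear1 (conn_curvC Z X) (conn_curvC Z Y).
by rewrite scalerN opprD !opprK.
Qed.

(** First derivatives of [a] cancel between the two orders of differentiation; its second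
    derivatives cancel against the bracket term by [der_along_bracket]. *)
Lemma conn_curv_linear3 a X Y Z W :
  conn_curv X Y (a *: Z + W) = a *: conn_curv X Y Z + conn_curv X Y W.
Proof.
rewrite /conn_curv !(connD, connZ) der_along_bracket.
by apply/rowP => k; rewrite !mxE; ring.
Qed.

Lemma conn_curv_coord i j Z :
  conn_curv (e i) (e j) Z = conn (e j) (conn (e i) Z) - conn (e i) (conn (e j) Z).
Proof. by rewrite /conn_curv bracket_coord conn0l addr0. Qed.

Lemma conn2_bilinear X T : bilinear_form T -> bilinear_form (conn2 X T).
Proof.
move=> [T1 T2]; split=> [Z|Y] a U V; rewrite /conn2 connD connZ.
  rewrite !(T1 _) !(linear_formD (T1 _)) !(linear_formZ (T1 _)).
  by rewrite der_alongD der_alongM; ring.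
rewrite !(T2 _) !(linear_formD (T2 _)) !(linear_formZ (T2 _)).
by rewrite der_alongD der_alongM; ring.
Qed.

Lemma conn4_quadrilinear X T :
  quadrilinear_form T -> quadrilinear_form (conn4 X T).
Proof.
move=> [T1 T2 T3 T4]; split=> ? ? ? a U V; rewrite /conn4 connD connZ.
- rewrite !(T1 _ _ _) !(linear_formD (T1 _ _ _)) !(linear_formZ (T1 _ _ _)).
  by rewrite der_alongD der_alongM; ring.
- rewrite !(T2 _ _ _) !(linear_formD (T2 _ _ _)) !(linear_formZ (T2 _ _ _)).
  by rewrite der_alongD der_alongM; ring.
- rewrite !(T3 _ _ _) !(linear_formD (T3 _ _ _)) !(linear_formZ (T3 _ _ _)).
  by rewrite der_alongD der_alongM; ring.
- rewrite !(T4 _ _ _) !(linear_formD (T4 _ _ _)) !(linear_formZ (T4 _ _ _)).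
  by rewrite der_alongD der_alongM; ring.
Qed.

Lemma conn2_linear T Y Z : bilinear_form T ->
  linear_form (fun X => conn2 X T Y Z).
Proof.
move=> [T1 T2] a X X'; rewrite /conn2 der_along_linear !conn_linear.
by rewrite (T1 _) (T2 _); ring.
Qed.

Lemma conn4_linear T Y Z U W : quadrilinear_form T ->
  linear_form (fun X => conn4 X T Y Z U W).
Proof.
move=> [T1 T2 T3 T4] a X X'; rewrite /conn4 der_along_linear !conn_linear.
by rewrite (T1 _ _ _) (T2 _ _ _) (T3 _ _ _) (T4 _ _ _); ring.
Qed.

(* In the commutator of two Hessians the first-order cross terms cancel and only
   [conn_curv], with its own sign convention, remains. *)
Lemma hess2_comm i j T Y Z : bilinear_form T ->
    conn (e i) (e j) = conn (e j) (e i) ->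
  hess2 (e i) (e j) T Y Z - hess2 (e j) (e i) T Y Z =
  T (conn_curv (e i) (e j) Y) Z + T Y (conn_curv (e i) (e j) Z).
Proof.
move=> [T1 T2] ij; rewrite /hess2 ij /conn2 !conn_curv_coord !der_along_coord.
rewrite !(derivationB (dP _)) (linear_formB (T1 _)) (linear_formB (T2 _)).
by rewrite (dC j i); ring.
Qed.

Lemma hess4_comm i j T Y Z U W : quadrilinear_form T ->
    conn (e i) (e j) = conn (e j) (e i) ->
  hess4 (e i) (e j) T Y Z U W - hess4 (e j) (e i) T Y Z U W =
  T (conn_curv (e i) (e j) Y) Z U W + T Y (conn_curv (e i) (e j) Z) U W
  + T Y Z (conn_curv (e i) (e j) U) W + T Y Z U (conn_curv (e i) (e j) W).
Proof.
move=> [T1 T2 T3 T4] ij.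
rewrite /hess4 ij /conn4 !conn_curv_coord !der_along_coord.
rewrite !(derivationB (dP _)) (linear_formB (T1 _ _ _)).
rewrite (linear_formB (T2 _ _ _)) (linear_formB (T3 _ _ _)).
rewrite (linear_formB (T4 _ _ _)) (dC j i).
by ring.
Qed.

End Connection.

(** * Curvature of a metric and its evolution *)

Section LeviCivita.
Context {A : comNzRingType} {m : nat}.
Implicit Types (X Y Z U V W : 'rV[A]_m).
Local Notation e i := (@delta_mx A 1 m 0 i).

Definition scalar_prod (G : 'M[A]_m) X Y : A := (X *m G *m Y^T) 0 0.

Lemma scalar_prod_bilinear G : bilinear_form (scalar_prod G).
Proof.
split=> [Z|Z] a X Y; rewrite /scalar_prod.
  by rewrite !mulmxDl -!scalemxAl !mxE.
by rewrite linearD linearZ /= mulmxDr -scalemxAr !mxE.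
Qed.

Lemma scalar_prodC G X Y : G^T = G -> scalar_prod G X Y = scalar_prod G Y X.
Proof.
move=> GT; rewrite /scalar_prod -[in LHS](trmxK (X *m G *m Y^T)) mxE.
by rewrite !trmx_mul trmxK GT mulmxA.
Qed.

Lemma scalar_prod_coord G i j : scalar_prod G (e i) (e j) = G i j.
Proof. by rewrite /scalar_prod -rowE trmx_delta -colE !mxE. Qed.

Lemma derivation_scalar_prod d G X Y : derivation d ->
  d (scalar_prod G X Y) = scalar_prod G (map_mx d X) Y
  + scalar_prod (map_mx d G) X Y + scalar_prod G X (map_mx d Y).
Proof.
move=> dP; rewrite /scalar_prod -[LHS](mxE map_mx_key (fun i j => d (_ i j))).
rewrite -/(map_mx d _) !(derivation_mulmx dP) map_trmx mulmxDl [LHS]mxE.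
by rewrite [in LHS]mxE.
Qed.

Context (d : 'I_m -> A -> A) (Gam : 'I_m -> 'I_m -> 'I_m -> A) (G H : 'M[A]_m).

(** The Christoffel symbols of [G]. A commutative ring need not contain $1/2$ or an inverse of [G],
    so [half] and [H] are supplied from outside. *)
Definition metric_conn (half : A) (k i j : 'I_m) : A :=
  half * \sum_l H k l * (d i (G j l) + d j (G i l) - d l (G i j)).

Definition curv_form X Y Z W : A := scalar_prod G (conn_curv d Gam X Y Z) W.

Context (dP : forall i, derivation (d i)).
Context (dC : forall i j a, d i (d j a) = d j (d i a)).
Context (GT : G^T = G) (GH : G *m H = 1%:M).

Lemma metric_connC half k i j : metric_conn half k i j = metric_conn half k j i.
Proof.
have Gs i' j' : G i' j' = G j' i' by rewrite -[in LHS]GT mxE.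
rewrite /metric_conn; congr (_ * _); apply: eq_bigr => l _.
by rewrite (Gs j i); ring.
Qed.

Lemma metric_conn_compat half i j k : half * 2 = 1 ->
  d i (G j k) = \sum_l metric_conn half l i j * G l k
              + \sum_l metric_conn half l i k * G j l.
Proof.
move=> half2; have Gs i' j' : G i' j' = G j' i' by rewrite -[in LHS]GT mxE.
(* Lowering the index cancels [H] and leaves Christoffel symbols of the first kind; in the sum of
   two of them only $2\cdot\frac12\,\partial_i G_{jk}$ survives. *)
have lower a b c : \sum_l metric_conn half l a b * G c l =
    half * (d a (G b c) + d b (G a c) - d c (G a b)).
  rewrite /metric_conn; under eq_bigr do rewrite -mulrA mulr_suml.
  rewrite -mulr_sumr exchange_big /=; congr (_ * _).
  transitivity (\sum_l (G *m H) c l *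
      (d a (G b l) + d b (G a l) - d l (G a b))).
    apply: eq_bigr => l _; rewrite mxE mulr_suml; apply: eq_bigr => p _.
    by ring.
  rewrite GH; under eq_bigr do rewrite mxE.
  rewrite (bigD1 c) //= eqxx mul1r big1 ?addr0 // => l lc.
  by rewrite eq_sym (negbTE lc) mul0r.
under eq_bigr do rewrite Gs.
rewrite !lower (Gs k j) (Gs i j).
by rewrite -[LHS]mul1r -half2; ring.
Qed.

(** * Curvature symmetries of a torsion-free metric connection *)

Context (GamC : forall k i j, Gam k i j = Gam k j i).
Context (compat : forall i j k, d i (G j k) =
  \sum_l Gam l i j * G l k + \sum_l Gam l i k * G j l).

Local Notation conn := (conn d Gam).
Local Notation conn_curv := (conn_curv d Gam).
Local Notation conn2 := (conn2 d Gam).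
Local Notation conn4 := (conn4 d Gam).
Local Notation hess2 := (hess2 d Gam).
Local Notation hess4 := (hess4 d Gam).
Local Notation inner := (scalar_prod G).

Lemma conn_coordE i Y :
  conn (e i) Y = map_mx (d i) Y + Y *m \matrix_(j, k) Gam k i j.
Proof.
apply/rowP => k; rewrite !mxE der_along_coord; congr (_ + _).
under eq_bigr => p _.
  under eq_bigr => q _ do rewrite mulrAC mulrC.
  rewrite -mulr_sumr; over.
rewrite sum_delta; apply: eq_bigr => j _; rewrite mxE; ring.
Qed.

Lemma derivation_coord (dd : A -> A) i : derivation dd -> map_mx dd (e i) = 0.
Proof.
move=> ddP; apply/rowP => k; rewrite !mxE !eqxx /=.
by case: eqP => _; rewrite ?(derivation0 ddP) ?(derivation1 ddP).
Qed.

Lemma conn_coord2 i j : conn (e i) (e j) = \row_k Gam k i j.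
Proof.
rewrite conn_coordE derivation_coord // add0r -rowE.
by apply/rowP => k; rewrite !mxE.
Qed.

Lemma conn_coordC i j : conn (e i) (e j) = conn (e j) (e i).
Proof. by rewrite !conn_coord2; apply/rowP => k; rewrite !mxE. Qed.

Lemma der_along_inner X Y Z :
  der_along d X (inner Y Z) = inner (conn X Y) Z + inner Y (conn X Z).
Proof.
have [innL innR] := scalar_prod_bilinear G.
apply: (linear_form_eq (der_along_linear _ _)
  (F' := fun X => inner (conn X Y) Z + inner Y (conn X Z))) => [|i].
  by move=> a U V; rewrite !conn_linear (innL _) (innR _); ring.
rewrite der_along_coord derivation_scalar_prod // !conn_coordE.
rewrite (linear_formD (innL _)) (linear_formD (innR _)) -!addrA; congr (_ + _).
rewrite [LHS]addrC [RHS]addrCA; congr (_ + _).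
(* Metric compatibility in matrix form, $\partial_i G=\Gamma_iG+G\Gamma_i^T$, matching the matrix
   form [conn_coordE] of the connection. *)
have -> : map_mx (d i) G = (\matrix_(j, k) Gam k i j) *m G
                           + G *m (\matrix_(j, k) Gam k i j)^T.
  apply/matrixP => j k; rewrite !mxE compat.
  congr (_ + _); apply: eq_bigr => l _; rewrite !mxE //; ring.
by rewrite /scalar_prod mulmxDr mulmxDl mxE trmx_mul !mulmxA.
Qed.

Let innL Y : linear_form (inner^~ Y) := (scalar_prod_bilinear G).1 Y.
Let innR X : linear_form (inner X) := (scalar_prod_bilinear G).2 X.

Let innB X Y Z : inner (X - Y) Z = inner X Z - inner Y Z.
Proof. exact: linear_formB (innL Z) X Y. Qed.

Lemma curv_form_quadrilinear : quadrilinear_form curv_form.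
Proof.
split=> ? ? ? a X Y; rewrite /curv_form.
- by rewrite conn_curv_linear1 // innL.
- by rewrite conn_curv_linear2 // innL.
- by rewrite conn_curv_linear3 // innL.
- by rewrite innR.
Qed.

Lemma curv_formC12 X Y Z W : curv_form Y X Z W = - curv_form X Y Z W.
Proof.
by rewrite /curv_form conn_curvC // -scaleN1r (linear_formZ (innL _)) mulN1r.
Qed.

(** Applied to the function [inner Z W], the commutator of second derivatives corrected by the
    bracket gives zero. Expanding by metric compatibility, the mixed first-order terms cancel, and
    what remains is $g(R(X,Y)Z,W)+g(Z,R(X,Y)W)=0$. *)
Lemma curv_formC34 X Y Z W : curv_form X Y W Z = - curv_form X Y Z W.
Proof.
have := der_along_bracket dP dC X Y (inner Z W).
rewrite !der_along_inner !der_alongD // !der_along_inner => E.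
rewrite /curv_form /conn_curv !(linear_formB (innL _), linear_formD (innL _)).
rewrite !(scalar_prodC _ Z GT).
move/eqP: E; rewrite -subr_eq0 => /eqP E; apply/eqP; rewrite -subr_eq0.
by apply/eqP; rewrite -[RHS]E; ring.
Qed.

(** No bracket terms occur on coordinate fields, and absence of torsion makes the six second
    derivatives cancel in pairs. *)
Lemma conn_curv_bianchi i j k :
  conn_curv (e i) (e j) (e k) + conn_curv (e j) (e k) (e i)
  + conn_curv (e k) (e i) (e j) = 0.
Proof.
rewrite !conn_curv_coord // (conn_coordC j i) (conn_coordC k i) (conn_coordC k j).
by apply/rowP => p; rewrite !mxE; ring.
Qed.

Lemma curv_form_bianchi i j k W :
  curv_form (e i) (e j) (e k) W + curv_form (e j) (e k) (e i) W
  + curv_form (e k) (e i) (e j) W = 0.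
Proof.
rewrite /curv_form -!(linear_formD (innL _)) conn_curv_bianchi.
exact: linear_form0 (innL _).
Qed.

Context (half : A) (half2 : half * 2 = 1).

(** Milnor's octahedron: with $a=R_{ijkl}$, $b=R_{jkil}$, $c=R_{kijl}$, $a'=R_{klij}$, $u=R_{ljki}$,
    $v=R_{likj}$, the hypotheses are the four first Bianchi identities after use of the
    antisymmetries. Their alternating sum is $2(a-a')$. *)
Let octahedron (a b c a' u v : A) : a + b + c = 0 -> - b - a' + u = 0 ->
  a' + v + c = 0 -> - v - a + u = 0 -> a' = a.
Proof.
move=> B1 B2 B3 B4.
have E : 2 * (a - a') =
  (a + b + c) - (a' + v + c) + (- b - a' + u) - (- v - a + u) by ring.
have -> : a' = a - half * 2 * (a - a') by rewrite half2; ring.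
by rewrite -mulrA E B1 B2 B3 B4 !(addr0, subr0) mulr0 subr0.
Qed.

Lemma curv_form_pair X Y Z W : curv_form Z W X Y = curv_form X Y Z W.
Proof.
have [R1 R2 R3 R4] := curv_form_quadrilinear.
apply: (quadrilinear_form_eq (T := fun X Y Z W => curv_form Z W X Y)
          _ curv_form_quadrilinear).
  by split=> ? ? ?; [exact: R3|exact: R4|exact: R1|exact: R2].
move=> i j k l /=.
have B1 := curv_form_bianchi i j k (e l).
have B2 := curv_form_bianchi j k l (e i).
have B3 := curv_form_bianchi k l i (e j).
have B4 := curv_form_bianchi l i j (e k).
move: B1 B2 B3 B4.
rewrite (curv_formC34 (e j) (e k) (e i) (e l)) (curv_formC34 (e k) (e l) (e i) (e j)).
rewrite (curv_formC12 (e k) (e i)) (curv_formC34 (e k) (e i) (e j) (e l)) opprK.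
rewrite (curv_formC34 (e l) (e i) (e k) (e j)) (curv_formC34 (e i) (e j) (e k) (e l)).
rewrite (curv_formC12 (e l) (e j)) (curv_formC34 (e l) (e j) (e k) (e i)) opprK.
exact: octahedron.
Qed.

Lemma curv_form_bianchi2 X Y Z V W :
  conn4 X curv_form Y Z V W + conn4 Y curv_form Z X V W
  + conn4 Z curv_form X Y V W = 0.
Proof.
have RQ := curv_form_quadrilinear.
have cRL Y' Z' V' W' := conn4_linear d Gam Y' Z' V' W' RQ.
have cR1 X' Z' V' W' : linear_form (fun Y => conn4 X' curv_form Y Z' V' W').
  by have [] := conn4_quadrilinear Gam dP X' RQ.
have cR2 X' Y' V' W' : linear_form (fun Z => conn4 X' curv_form Y' Z V' W').
  by have [] := conn4_quadrilinear Gam dP X' RQ.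
have zero_lin : linear_form (fun=> 0 : A) by move=> ? ? ?; rewrite mulr0 addr0.
apply: (linear_form_eq (F' := fun=> 0)
    (F := fun X => conn4 X curv_form Y Z V W + conn4 Y curv_form Z X V W
                   + conn4 Z curv_form X Y V W)) => //.
  by move=> a ? ?; rewrite (cRL _ _ _ _) (cR1 _ _ _ _) (cR2 _ _ _ _); ring.
move=> a; apply: (linear_form_eq (F' := fun=> 0)
    (F := fun Y => conn4 (e a) curv_form Y Z V W + conn4 Y curv_form Z (e a) V W
                   + conn4 Z curv_form (e a) Y V W)) => //.
  by move=> b ? ?; rewrite (cRL _ _ _ _) (cR1 _ _ _ _) (cR2 _ _ _ _); ring.
move=> i; apply: (linear_form_eq (F' := fun=> 0)
    (F := fun Z => conn4 (e a) curv_form (e i) Z V W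
                   + conn4 (e i) curv_form Z (e a) V W
                   + conn4 Z curv_form (e a) (e i) V W)) => //.
  by move=> b ? ?; rewrite (cRL _ _ _ _) (cR1 _ _ _ _) (cR2 _ _ _ _); ring.
move=> j; rewrite /conn4.
(* By symmetry of the connection, the six terms with a derivative in one of the first two slots
   cancel in pairs under antisymmetry. *)
rewrite (conn_coordC i a) (conn_coordC j a) (conn_coordC j i).
rewrite (curv_formC12 (e a) (conn (e i) (e j))).
rewrite (curv_formC12 (e i) (conn (e a) (e j))).
rewrite (curv_formC12 (e j) (conn (e a) (e i))).
(* What remains is the Jacobi identity for the three operators $\nabla_a,\nabla_i,\nabla_j$ applied
   to [V]. *)
rewrite /curv_form !der_along_inner !conn_curv_coord //.
by move: (e a) (e i) (e j) => x y z; rewrite !connB // !innB; ring.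
Qed.

(** * Symmetries and Bianchi identity for the Hessian of the curvature *)

Section Symmetries.
Context {T : 'rV[A]_m -> 'rV[A]_m -> 'rV[A]_m -> 'rV[A]_m -> A}.

(** [T] is arbitrary so that the symmetry can be passed from the curvature to its covariant
    derivative and from there to its Hessian. *)
Lemma conn4C12 U X Y Z W : (forall X Y Z W, T Y X Z W = - T X Y Z W) ->
  conn4 U T Y X Z W = - conn4 U T X Y Z W.
Proof.
move=> TC; rewrite /conn4 !(TC X) (TC (conn U X)).
by rewrite (derivationN (der_along_derivation dP U)); ring.
Qed.

Lemma conn4_pair U X Y Z W : (forall X Y Z W, T Z W X Y = T X Y Z W) ->
  conn4 U T Z W X Y = conn4 U T X Y Z W.
Proof.
move=> TC; rewrite /conn4 !(TC X Y) (TC (conn U X)) (TC _ (conn U Y)).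
by ring.
Qed.

End Symmetries.

Local Notation R := curv_form.

Lemma hess4_curvC12 U V X Y Z W : hess4 U V R Y X Z W = - hess4 U V R X Y Z W.
Proof.
rewrite /hess4 !(conn4C12 _ X Y); first by ring.
- exact: curv_formC12.
- by move=> *; apply: conn4C12; exact: curv_formC12.
Qed.

Lemma hess4_curv_pair U V X Y Z W : hess4 U V R Z W X Y = hess4 U V R X Y Z W.
Proof.
rewrite /hess4 !(conn4_pair _ X Y) //; first exact: curv_form_pair.
by move=> *; apply: conn4_pair; exact: curv_form_pair.
Qed.

(** Unfolds the outer derivative only: the inner [conn4] must stay folded for the second Bianchi
    identity to apply. *)
Let hess4E U X T Y Z V W : hess4 U X T Y Z V W =
  der_along d U (conn4 X T Y Z V W)
  - conn4 X T (conn U Y) Z V W - conn4 X T Y (conn U Z) V W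
  - conn4 X T Y Z (conn U V) W - conn4 X T Y Z V (conn U W)
  - conn4 (conn U X) T Y Z V W.
Proof. by []. Qed.

Lemma hess4_curv_bianchi U X Y Z V W :
  hess4 U X R Y Z V W + hess4 U Y R Z X V W + hess4 U Z R X Y V W = 0.
Proof.
have B := curv_form_bianchi2.
have D := derivation0 (der_along_derivation dP U).
have DD := (der_along_derivation dP U).1.
(* Zero is rewritten as the derivative along [U] of the vanishing Bianchi sum, minus the five
   vanishing sums in which one argument is replaced by its derivative along [U]. *)
rewrite -[RHS]D -(B X Y Z V W) 2!DD.
rewrite -[RHS]subr0 -(B (conn U X) Y Z V W) -[RHS]subr0 -(B X (conn U Y) Z V W).
rewrite -[RHS]subr0 -(B X Y (conn U Z) V W) -[RHS]subr0 -(B X Y Z (conn U V) W).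
rewrite -[RHS]subr0 -(B X Y Z V (conn U W)).
by rewrite !hess4E; ring.
Qed.

(** * Traces with the inverse metric *)

Definition contract (F : 'I_m -> 'I_m -> A) : A := \sum_p \sum_q H p q * F p q.

Lemma contractD F F' :
  contract F + contract F' = contract (fun p q => F p q + F' p q).
Proof.
rewrite -big_split /=; apply: eq_bigr => p _; rewrite -big_split /=.
by apply: eq_bigr => q _; rewrite mulrDr.
Qed.

Lemma eq_contract F F' : (forall p q, F p q = F' p q) -> contract F = contract F'.
Proof.
by move=> FF; apply: eq_bigr => p _; apply: eq_bigr => q _; rewrite FF.
Qed.

Lemma contractN F : - contract F = contract (fun p q => - F p q).
Proof.
rewrite -sumrN; apply: eq_bigr => p _; rewrite -sumrN.
by apply: eq_bigr => q _; rewrite mulrN.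
Qed.

Lemma inverse_sym : H^T = H.
Proof.
have HTG : H^T *m G = 1%:M by rewrite -{1}GT -trmx_mul GH trmx1.
by rewrite -[LHS]mulmx1 -GH mulmxA HTG mul1mx.
Qed.

Lemma contractC F : contract F = contract (fun p q => F q p).
Proof.
rewrite /contract exchange_big; apply: eq_bigr => p _; apply: eq_bigr => q _.
by rewrite -[in LHS]inverse_sym mxE.
Qed.

(** The components of [V] are recovered by raising the index of [inner V (e p)]. When [V] is a
    curvature vector placed in a slot of $R$, this gives a contraction of two curvature
    components. *)
Lemma linear_form_contract F V : linear_form F ->
  F V = contract (fun p q => inner V (e p) * F (e q)).
Proof.
move=> FL; rewrite /contract exchange_big /= (linear_form_expand FL).
apply: eq_bigr => q _; under eq_bigr do rewrite mulrA.
rewrite -mulr_suml; congr (_ * _).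
have -> : V 0 q = (V *m G *m H) 0 q by rewrite -mulmxA GH mulmx1.
rewrite [LHS]mxE; apply: eq_bigr => p _; rewrite mulrC; congr (_ * _).
by rewrite /scalar_prod trmx_delta -colE [in RHS]mxE.
Qed.

(** * From four Hessians to the second derivative along [o] *)

(** For each of the outer indices $i$, $j$ this is one second Bianchi identity in $k,l,o$, applied
    after exchanging pairs so that these three sit in the cyclic slots. *)
Lemma hess4_curv_heat o i j k l :
  hess4 (e i) (e k) R (e j) o (e l) o - hess4 (e i) (e l) R (e j) o (e k) o
  - hess4 (e j) (e k) R (e i) o (e l) o + hess4 (e j) (e l) R (e i) o (e k) o
  = - hess4 (e i) o R (e j) o (e k) (e l) + hess4 (e j) o R (e i) o (e k) (e l).
Proof.
have B1 := hess4_curv_bianchi (e i) (e k) (e l) o (e j) o.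
have B2 := hess4_curv_bianchi (e j) (e k) (e l) o (e i) o.
move: B1 B2; move: (e i) (e j) (e k) (e l) => x y z w B1 B2.
rewrite (hess4_curv_pair x z w o y o) (hess4_curv_pair y z w o x o).
rewrite (hess4_curv_pair x w z o y o) (hess4_curv_pair y w z o x o).
rewrite (hess4_curvC12 x w o z y o) (hess4_curvC12 y w o z x o).
rewrite (hess4_curv_pair x o z w y o) (hess4_curv_pair y o z w x o).
move/(canRL (addKr _)): B1 => ->; move/(canRL (addKr _)): B2 => ->.
by ring.
Qed.

(** The Ricci identity moves [o] to the outer derivative, at the cost of the two groups of four
    curvature terms; the second Bianchi identity in $i,j,o$ then merges the two Hessians into
    one. *)
Lemma hess4_curv_heat_coord o i j k l :
  - hess4 (e i) (e o) R (e j) (e o) (e k) (e l)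
  + hess4 (e j) (e o) R (e i) (e o) (e k) (e l)
  = hess4 (e o) (e o) R (e i) (e j) (e k) (e l)
  - (R (conn_curv (e i) (e o) (e j)) (e o) (e k) (e l)
     + R (e j) (conn_curv (e i) (e o) (e o)) (e k) (e l)
     + R (e j) (e o) (conn_curv (e i) (e o) (e k)) (e l)
     + R (e j) (e o) (e k) (conn_curv (e i) (e o) (e l)))
  + (R (conn_curv (e j) (e o) (e i)) (e o) (e k) (e l)
     + R (e i) (conn_curv (e j) (e o) (e o)) (e k) (e l)
     + R (e i) (e o) (conn_curv (e j) (e o) (e k)) (e l)
     + R (e i) (e o) (e k) (conn_curv (e j) (e o) (e l))).
Proof.
have RQ := curv_form_quadrilinear.
have C1 := hess4_comm dP dC (e j) (e o) (e k) (e l) RQ (conn_coordC i o).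
have C2 := hess4_comm dP dC (e i) (e o) (e k) (e l) RQ (conn_coordC j o).
have B := hess4_curv_bianchi (e o) (e i) (e j) (e o) (e k) (e l).
rewrite (hess4_curvC12 (e o) (e j) (e i) (e o)) in B.
move: R C1 C2 B {RQ} => T C1 C2 B; rewrite -{}C1 -{}C2.
by move/(canRL (addKr _)): B => ->; ring.
Qed.

Definition quad_form (T : 'I_m -> 'I_m -> 'I_m -> 'I_m -> A) o i j k l : A :=
  contract (fun p q => T p i j o * T q k l o).

(** The left-hand side is the Ricci identity's output after raising indices. Only the algebraic
    symmetries of curvature are involved, so [T] is a plain array of ring elements. *)
Let curvature_quadratic T o i j k l :
    (forall i j k l, T j i k l = - T i j k l) ->
    (forall i j k l, T i j l k = - T i j k l) ->
    (forall i j k l, T k l i j = T i j k l) ->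
    (forall i j k l, T i j k l + T j k i l + T k i j l = 0) ->
  - (contract (fun p q => T i o j p * T q o k l)
     + contract (fun p q => T i o o p * T j q k l)
     + contract (fun p q => T i o k p * T j o q l)
     + contract (fun p q => T i o l p * T j o k q))
  + (contract (fun p q => T j o i p * T q o k l)
     + contract (fun p q => T j o o p * T i q k l)
     + contract (fun p q => T j o k p * T i o q l)
     + contract (fun p q => T j o l p * T i o k q))
  = quad_form T o i j k l - quad_form T o i j l k
  - quad_form T o j i k l + quad_form T o j i l k
  - 2 * quad_form T o k j l i + 2 * quad_form T o k i l j
  - contract (fun p q => T q j k l * T i o p o + T i q k l * T j o p o).
Proof.
move=> T12 T34 Tp TB.
(* One of the two copies gets $p$ and $q$ exchanged, by symmetry of the inverse metric. With this
   choice the identity holds summand by summand, for fixed $p$ and $q$. *)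
have -> : 2 * quad_form T o k j l i = quad_form T o k j l i
    + contract (fun p q => T p l i o * T q k j o).
  rewrite mulr2n mulrDl mul1r; congr (_ + _); rewrite [LHS]contractC.
  by apply: eq_contract => p q; rewrite mulrC.
have -> : 2 * quad_form T o k i l j = quad_form T o k i l j
    + contract (fun p q => T p l j o * T q k i o).
  rewrite mulr2n mulrDl mul1r; congr (_ + _); rewrite [LHS]contractC.
  by apply: eq_contract => p q; rewrite mulrC.
rewrite /quad_form !(contractN, contractD).
apply: eq_contract => p q.
(* The first Bianchi identity and the antisymmetries express every factor through common
   representatives, after which only a polynomial identity is left. *)
have B1 : T i o j p = T j o i p - T p o i j.
  have := TB i o j p; rewrite (T12 j o) -(Tp j i) (T12 p o) (T34 _ _ i j) opprK.
  by move/eqP; rewrite addr_eq0 => /eqP E; rewrite -[LHS](addrK (- T j o i p)) E; ring.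
have B2 a b c : T a b c o = T a c b o - T a o b c.
  have := TB a b c o; rewrite (T12 a c) -(Tp b c).
  by move/eqP; rewrite addr_eq0 => /eqP E; rewrite -[LHS](addrK (T a o b c)) E; ring.
rewrite B1 (B2 p i j) (B2 q k l).
rewrite (T34 i o p o) (T34 j o p o) (T12 q j) (T12 q i).
rewrite -(Tp i o k p) -(Tp i o l p) -(Tp j o k p) -(Tp j o l p).
rewrite -(Tp i o k q) -(Tp i o q l) -(Tp j o k q) -(Tp j o q l).
rewrite !(T12 p k) !(T12 p l) !(T12 q k).
by ring.
Qed.

Local Notation Rm i j k l := (R (e i) (e j) (e k) (e l)).
Local Notation ric o i j := (Rm i o j o).
Local Notation Rc := (fun i j k l => Rm i j k l).

Lemma hess4_curv_heat_quad o i j k l :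
  hess4 (e i) (e k) R (e j) (e o) (e l) (e o)
  - hess4 (e i) (e l) R (e j) (e o) (e k) (e o)
  - hess4 (e j) (e k) R (e i) (e o) (e l) (e o)
  + hess4 (e j) (e l) R (e i) (e o) (e k) (e o)
  = hess4 (e o) (e o) R (e i) (e j) (e k) (e l)
  + (quad_form Rc o i j k l - quad_form Rc o i j l k
  - quad_form Rc o j i k l + quad_form Rc o j i l k
  - 2 * quad_form Rc o k j l i + 2 * quad_form Rc o k i l j
  - contract (fun p q => Rm q j k l * ric o i p + Rm i q k l * ric o j p)).
Proof.
have [R1 R2 R3 R4] := curv_form_quadrilinear.
rewrite hess4_curv_heat hess4_curv_heat_coord.
have E1 a b c Y Z W : R (conn_curv (e a) (e b) (e c)) Y Z W =
    contract (fun p q => Rm a b c p * R (e q) Y Z W).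
  exact: linear_form_contract (R1 _ _ _).
have E2 a b c Y Z W : R Y (conn_curv (e a) (e b) (e c)) Z W =
    contract (fun p q => Rm a b c p * R Y (e q) Z W).
  exact: linear_form_contract (R2 _ _ _).
have E3 a b c Y Z W : R Y Z (conn_curv (e a) (e b) (e c)) W =
    contract (fun p q => Rm a b c p * R Y Z (e q) W).
  exact: linear_form_contract (R3 _ _ _).
have E4 a b c Y Z W : R Y Z W (conn_curv (e a) (e b) (e c)) =
    contract (fun p q => Rm a b c p * R Y Z W (e q)).
  exact: linear_form_contract (R4 _ _ _).
rewrite !E1 !E2 !E3 !E4 -addrA; congr (_ + _).
apply: (curvature_quadratic (T := Rc)) => *.
- exact: curv_formC12.
- exact: curv_formC34.
- exact: curv_form_pair.
- exact: curv_form_bianchi.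
Qed.

(** * Variation of connection and curvature under [dt G = - 2 rho], for any symmetric bilinear
    [rho] *)

Section Evolution.
Context (dt : A -> A) (dtP : derivation dt).
Context (dtC : forall i a, dt (d i a) = d i (dt a)).
Context (rho : 'rV[A]_m -> 'rV[A]_m -> A) (rhoB : bilinear_form rho).
Context (rhoC : forall X Y, rho Y X = rho X Y).
Context (flow : forall i j, dt (G i j) = - 2 * rho (e i) (e j)).

Lemma metric_dot X Y : scalar_prod (map_mx dt G) X Y = - 2 * rho X Y.
Proof.
have [h1 h2] := scalar_prod_bilinear (map_mx dt G); have [r1 r2] := rhoB.
apply: (linear_form_eq (h1 Y) (F' := fun X => - 2 * rho X Y)) => [a U V|i].
  by rewrite r1; ring.
apply: (linear_form_eq (h2 _) (F' := fun Y => - 2 * rho (e i) Y)) => [a U V|j].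
  by rewrite r2; ring.
by rewrite scalar_prod_coord mxE flow.
Qed.

(** The variation of the connection, $\dot\Gamma(X,Y)$: no derivative of [Y] occurs, so it is a
    tensor in both arguments. *)
Definition conn_dot X Y : 'rV[A]_m :=
  \row_k \sum_i \sum_j dt (Gam k i j) * X 0 i * Y 0 j.

Lemma derivation_conn X Y : map_mx dt (conn X Y) =
  conn_dot X Y + conn (map_mx dt X) Y + conn X (map_mx dt Y).
Proof.
apply/rowP => k; rewrite !mxE dtP.1 /der_along !(derivation_sum dtP).
rewrite -!big_split /=; apply: eq_bigr => i _.
rewrite !(derivation_sum dtP) dtP.2 dtC !mxE.
transitivity (dt (X 0 i) * d i (Y 0 k) + X 0 i * d i (dt (Y 0 k)) +
  (\sum_j dt (Gam k i j) * X 0 i * Y 0 j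
   + \sum_j Gam k i j * dt (X 0 i) * Y 0 j
   + \sum_j Gam k i j * X 0 i * dt (Y 0 j))).
  congr (_ + _); rewrite -!big_split /=; apply: eq_bigr => j _.
  by rewrite !dtP.2; ring.
under [\sum_j Gam k i j * X 0 i * map_mx dt Y 0 j]eq_bigr do rewrite mxE.
ring.
Qed.

Lemma conn_dotC X Y : conn_dot X Y = conn_dot Y X.
Proof.
apply/rowP => k; rewrite !mxE exchange_big; apply: eq_bigr => i _.
by apply: eq_bigr => j _; rewrite GamC; ring.
Qed.

Lemma conn_dot_linear a X Y Z :
  conn_dot (a *: X + Y) Z = a *: conn_dot X Z + conn_dot Y Z.
Proof.
apply/rowP => k; rewrite !mxE mulr_sumr -big_split /=.
apply: eq_bigr => i _; rewrite mulr_sumr -big_split /=.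
by apply: eq_bigr => j _; rewrite !mxE; ring.
Qed.

Let dt_coord i : map_mx dt (e i) = 0.
Proof. exact: derivation_coord. Qed.

Let dt_conn_coord i j : map_mx dt (conn (e i) (e j)) = conn_dot (e i) (e j).
Proof. by rewrite derivation_conn !dt_coord conn0l conn0 // !addr0. Qed.

Let dt_inner X Y : dt (inner X Y) =
  inner (map_mx dt X) Y - 2 * rho X Y + inner X (map_mx dt Y).
Proof. by rewrite derivation_scalar_prod // metric_dot mulNr. Qed.

(** The time derivative of metric compatibility on coordinate fields, whose components are constant
    in time. *)
Let conn2_metric_dot i j k :
  - 2 * conn2 (e i) rho (e j) (e k) =
  inner (conn_dot (e i) (e j)) (e k) + inner (conn_dot (e i) (e k)) (e j).
Proof.
have := congr1 dt (der_along_inner (e i) (e j) (e k)).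
rewrite dtP.1 !dt_inner !dt_conn_coord !dt_coord der_along_coord dtC dt_inner.
rewrite !dt_coord !(linear_form0 (innL _)) !(linear_form0 (innR _)).
rewrite !(add0r, addr0) (derivationN (dP i)) (dP i).2.
have -> : d i 2 = 0 by rewrite mulr2n (dP i).1 (derivation1 (dP i)) addr0.
rewrite mul0r add0r /conn2 der_along_coord => E.
rewrite [inner (conn_dot (e i) (e k)) _]scalar_prodC //.
rewrite mulNr !mulrBr !opprB [LHS]addrC.
by apply/eqP; rewrite -subr_eq0; move/eqP: E; rewrite -subr_eq0 => /eqP <-; apply/eqP; ring.
Qed.

(** Koszul's trick for the variation: three permuted instances of [conn2_metric_dot] are combined
    using the symmetry of [conn_dot], and [half] removes the common factor 2. *)
Lemma conn_dotE X Y Z : inner (conn_dot X Y) Z =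
  - (conn2 X rho Y Z + conn2 Y rho X Z - conn2 Z rho X Y).
Proof.
have L1 Y' Z' := conn2_linear d Gam Y' Z' rhoB.
have L2 X' Z' : linear_form (fun Y => conn2 X' rho Y Z').
  by have [] := conn2_bilinear Gam dP X' rhoB.
have L3 X' Y' : linear_form (fun Z => conn2 X' rho Y' Z).
  by have [] := conn2_bilinear Gam dP X' rhoB.
apply: (linear_form_eq (F := fun X => inner (conn_dot X Y) Z)
  (F' := fun X => - (conn2 X rho Y Z + conn2 Y rho X Z - conn2 Z rho X Y)))
  => [a U V|a U V|i].
- by rewrite conn_dot_linear innL.
- by rewrite (L1 _ _) (L2 _ _) (L2 _ _); ring.
apply: (linear_form_eq (F := fun Y => inner (conn_dot (e i) Y) Z)
  (F' := fun Y => - (conn2 (e i) rho Y Z + conn2 Y rho (e i) Z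
                     - conn2 Z rho (e i) Y))) => [a U V|a U V|j].
- by rewrite !(conn_dotC (e i)) conn_dot_linear innL.
- by rewrite (L1 _ _) (L2 _ _) (L3 _ _); ring.
apply: (linear_form_eq (innR _)
  (F' := fun Z => - (conn2 (e i) rho (e j) Z + conn2 (e j) rho (e i) Z
                     - conn2 Z rho (e i) (e j)))) => [a U V|k].
  by rewrite (L1 _ _) (L3 _ _) (L3 _ _); ring.
have E1 := conn2_metric_dot i j k; have E2 := conn2_metric_dot j i k.
have E3 := conn2_metric_dot k i j.
rewrite (conn_dotC (e j)) in E2; rewrite !(conn_dotC (e k)) in E3.
rewrite -[LHS]mul1r -[RHS]mul1r -half2 -!mulrA; congr (_ * _).
have -> (u v w : A) : 2 * (- (u + v - w)) = - 2 * u + - 2 * v - (- 2 * w).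
  by ring.
by rewrite E1 E2 E3; ring.
Qed.

(** Differentiating the commutator of covariant derivatives gives six Hessians of [rho]. The two
    acting on [rho (e k) (e l)] differ only in the order of $i$ and $j$; the Ricci identity turns
    them into curvature terms, which reduce the coefficient $-2$ from the varying metric to $-1$. *)
Lemma curv_form_dot i j k l : dt (R (e i) (e j) (e k) (e l)) =
  hess2 (e i) (e k) rho (e j) (e l) - hess2 (e i) (e l) rho (e j) (e k)
  - hess2 (e j) (e k) rho (e i) (e l) + hess2 (e j) (e l) rho (e i) (e k)
  - rho (conn_curv (e i) (e j) (e k)) (e l)
  + rho (e k) (conn_curv (e i) (e j) (e l)).
Proof.
have Hc := hess2_comm dP dC (e k) (e l) rhoB (conn_coordC j i).
have -> : dt (R (e i) (e j) (e k) (e l)) =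
    - 2 * rho (conn_curv (e i) (e j) (e k)) (e l)
    + inner (conn_dot (e j) (conn (e i) (e k))) (e l)
    + (d j (inner (conn_dot (e i) (e k)) (e l))
       - inner (conn_dot (e i) (e k)) (conn (e j) (e l)))
    - inner (conn_dot (e i) (conn (e j) (e k))) (e l)
    - (d i (inner (conn_dot (e j) (e k)) (e l))
       - inner (conn_dot (e j) (e k)) (conn (e i) (e l))).
  (* Moving the outer derivative off [conn_dot] leaves it only inside inner products, where
     [conn_dotE] applies. *)
  have Mix a b : inner (conn (e a) (conn_dot (e b) (e k))) (e l) =
      d a (inner (conn_dot (e b) (e k)) (e l))
      - inner (conn_dot (e b) (e k)) (conn (e a) (e l)).
    by rewrite -der_along_coord der_along_inner addrK.
  rewrite /curv_form dt_inner dt_coord (linear_form0 (innR _)) addr0.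
  rewrite -!Mix conn_curv_coord // (derivation_mxB dtP) !derivation_conn !dt_coord.
  rewrite !(conn0l, conn0 Gam dP, dt_conn_coord, addr0).
  move: (e i) (e j) (e k) (e l) => x y z w; rewrite innB.
  by rewrite !(linear_formD (innL _)); ring.
have dE a u v w : d a (- (u + v - w)) = - (d a u + d a v - d a w).
  by rewrite (derivationN (dP a)) (derivationB (dP a)) (dP a).1.
rewrite !conn_dotE !dE => {dE}.
have S u X Y v : conn2 u rho (conn X Y) v = conn2 u rho v (conn X Y).
  by rewrite /conn2 !(rhoC v) (rhoC (conn u v)); ring.
move: Hc; rewrite !(conn_curvC d Gam (e i)) // -![- conn_curv _ _ _]scaleN1r.
have [r1 r2] := rhoB; rewrite (linear_formZ (r1 _)) (linear_formZ (r2 _)) !mulN1r.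
have hessE X Y Z W : hess2 X Y rho Z W = der_along d X (conn2 Y rho Z W)
  - conn2 Y rho (conn X Z) W - conn2 Y rho Z (conn X W)
  - conn2 (conn X Y) rho Z W by [].
rewrite !hessE !der_along_coord (conn_coordC j i) !S => {hessE S}.
move: (conn_curv _ _ (e k)) (conn_curv _ _ (e l)) => U V.
move: (e i) (e j) (e k) (e l) => x y z w /eqP; rewrite -subr_eq0 => /eqP E.
by apply/eqP; rewrite -subr_eq0 -oppr_eq0 -E; apply/eqP; ring.
Qed.

End Evolution.

(** A linear combination of [curv_form_dot], with [rho] taken to be [r], and [hess4_curv_heat_quad].
    The former supplies the terms with $r_{kp}$ and $r_{lp}$, the latter those with $r_{ip}$ and
    $r_{jp}$. *)
Theorem curv_form_evolution (dt : A -> A) (o i j k l : 'I_m) :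
    derivation dt -> (forall i a, dt (d i a) = d i (dt a)) ->
    (forall i j, dt (G i j) = - 2 * Rm i o j o) ->
  let r := fun X Y => R X (e o) Y (e o) in
  let B := quad_form Rc o in
  let Q i k j l := hess4 (e i) (e k) R (e j) (e o) (e l) (e o)
                   - hess2 (e i) (e k) r (e j) (e l) in
  dt (Rm i j k l) = hess4 (e o) (e o) R (e i) (e j) (e k) (e l)
    + B i j k l - B i j l k - B j i k l + B j i l k
    - 2 * B k j l i + 2 * B k i l j
    - \sum_p \sum_q H p q *
        (Rm q j k l * r (e i) (e p) + Rm i q k l * r (e j) (e p)
         + Rm i j q l * r (e k) (e p) + Rm i j k q * r (e l) (e p))
    - (Q i k j l - Q i l j k - Q j k i l + Q j l i k).
Proof.
move=> dtP dtC flow r B Q.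
have [R1 R2 R3 R4] := curv_form_quadrilinear.
have rB : bilinear_form r by split=> [Y|X]; [exact: R1|exact: R3].
have rC X Y : r Y X = r X Y by exact: curv_form_pair.
have := curv_form_dot dtP dtC rB rC flow i j k l.
have -> : r (conn_curv (e i) (e j) (e k)) (e l) =
    contract (fun p q => Rm i j k q * r (e l) (e p)).
  rewrite (linear_form_contract _ (rB.1 _)) contractC.
  by apply: eq_contract => p q; rewrite [r _ (e l)]rC.
have -> : r (e k) (conn_curv (e i) (e j) (e l)) =
    contract (fun p q => - Rm i j q l * r (e k) (e p)).
  rewrite (linear_form_contract _ (rB.2 _)) contractC.
  by apply: eq_contract => p q; rewrite -curv_formC34.
have := hess4_curv_heat_quad o i j k l; rewrite -/B.
have -> : \sum_p \sum_q H p q *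
        (Rm q j k l * r (e i) (e p) + Rm i q k l * r (e j) (e p)
         + Rm i j q l * r (e k) (e p) + Rm i j k q * r (e l) (e p)) =
    contract (fun p q => Rm q j k l * r (e i) (e p) + Rm i q k l * r (e j) (e p))
    - contract (fun p q => - Rm i j q l * r (e k) (e p))
    + contract (fun p q => Rm i j k q * r (e l) (e p)).
  rewrite contractN !contractD; apply: eq_bigr => p _; apply: eq_bigr => q _.
  by move: (e i) (e j) (e k) (e l) (e p) (e q) => x y z w u v; ring.
move: (contract _) (contract _) (contract _) => c1 c2 c3.
rewrite {}/Q -/(ric o _ _); move: B => {}B.
move: r {rB rC} (e i) (e j) (e k) (e l) (e o) => {}r x y z w v.
move/eqP; rewrite -subr_eq0 => /eqP E ->.
by apply/eqP; rewrite -subr_eq0 -E; apply/eqP; ring.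
Qed.

End LeviCivita.

(** * Directional derivatives *)

Section DirectionalDerivatives.
Context {R : realType} {V : normedModType R}.
Implicit Types (f : V -> R) (x y v w : V).

Let near0_lt (e : R) : 0 < e -> \forall h \near (0 : R), `|h| < e.
Proof. exact: (@nbhs0_lt R R^o). Qed.

Lemma is_derive_line f y v s : derivable f (s *: v + y) v ->
  is_derive s (1 : R) (fun s : R => f (s *: v + y)) ('D_v f (s *: v + y)).
Proof.
have E : (fun h : R => h^-1 *: (((fun s : R => f (s *: v + y)) \o shift s) (h *: 1)
            - f (s *: v + y))) =
    (fun h : R => h^-1 *: ((f \o shift (s *: v + y)) (h *: v) - f (s *: v + y))).
  by apply/funext => h /=; rewrite scalerDl [h *: 1]mulr1 addrA.
by move=> fv; apply: DeriveDef; rewrite /derivable /derive E.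
Qed.

Lemma is_derive_translate f a x v df :
  is_derive (a + x) v f df -> is_derive x v (fun y => f (a + y)) df.
Proof.
have E : (fun h : R => h^-1 *: (((fun y => f (a + y)) \o shift x) (h *: v) - f (a + x))) =
    (fun h : R => h^-1 *: ((f \o shift (a + x)) (h *: v) - f (a + x))).
  by apply/funext => h /=; rewrite addrCA.
by move=> [fv <-]; apply: DeriveDef; rewrite /derivable /derive E.
Qed.

Lemma derive_dirZ f x v (a : R) : derivable f x v ->
  is_derive x (a *: v) f (a * 'D_v f x).
Proof.
have [->|a0] := eqVneq a 0; first by rewrite scale0r mul0r => _; exact: is_derive0.
move=> fv; suff cv : (fun h : R =>
    h^-1 *: ((f \o shift x) (h *: (a *: v)) - f x)) @ 0^' --> a * 'D_v f x.
  by apply: DeriveDef; [apply/cvg_ex; eexists; exact: cv|exact: cvg_lim].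
have -> : (fun h : R => h^-1 *: ((f \o shift x) (h *: (a *: v)) - f x)) =
    (fun h => a * ((h * a)^-1 *: ((f \o shift x) ((h * a) *: v) - f x))).
  apply/funext => h; rewrite scalerA /GRing.scale /=.
  by rewrite invfM [h^-1 / a]mulrC -mulrA mulVKf.
suff ca : (fun h : R => h * a) @ 0^' `=>` 0^'.
  by apply: cvgMl_tmp; exact: (cvg_comp _ _ ca fv).
move=> A A0.
have /nbhs_norm0P[e /= e0 eA] : \forall k \near (0 : R), k != 0 -> A k by exact: A0.
suff : \forall h \near (0 : R), h != 0 -> A (h * a) by [].
near=> h => h0; apply: eA; last by rewrite mulf_neq0.
rewrite /= normrM -ltr_pdivlMr ?normr_gt0 //; near: h.
by apply: near0_lt; rewrite divr_gt0 ?normr_gt0.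
Unshelve. all: by end_near. Qed.

Lemma mvt_dir f y v :
  (forall s : R, 0 <= s <= 1 -> derivable f (s *: v + y) v) ->
  exists2 s : R, 0 <= s <= 1 & f (v + y) - f y = 'D_v f (s *: v + y).
Proof.
move=> fv; have [||s s01] := MVT_segment (f := fun s : R => f (s *: v + y))
  (df := fun s => 'D_v f (s *: v + y)) ler01.
- move=> s; rewrite in_itv /= => /andP[s0 s1].
  by apply: is_derive_line; apply: fv; rewrite !ltW.
- apply: derivable_within_continuous => s; rewrite in_itv /= => s01.
  by have [] := is_derive_line (fv _ s01).
rewrite scale1r scale0r add0r subr0 mulr1 => E.
by exists s => //; move: s01; rewrite in_itv.
Qed.

(** Intermediate points given by the mean value theorem lie in this parallelogram, so local
    hypotheses at [x] hold there for small [h]. *)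
Lemma near_parallelogram (P : set V) x v w : (\forall y \near x, P y) ->
  \forall h \near (0 : R), forall s s' : R, 0 <= s <= 1 -> 0 <= s' <= 1 ->
    P (s *: (h *: v) + s' *: (h *: w) + x).
Proof.
move=> /nbhs_normP[e /= e0 eP]; near=> h => s s' /andP[s0 s1] /andP[s'0 s'1].
apply: eP; rewrite /ball_ /= opprD addrCA subrr addr0 normrN.
apply: (le_lt_trans (ler_normD _ _)).
rewrite !normrZ (ger0_norm s0) (ger0_norm s'0).
apply: (@le_lt_trans _ _ (`|h| * (`|v| + `|w|))).
  rewrite mulrDr lerD //; apply: ler_piMl => //; rewrite mulr_ge0 //.
(* The added 1 keeps the divisor positive when [v] and [w] both vanish. *)
have vw : 0 < `|v| + `|w| + 1 by rewrite ltr_wpDl // addr_ge0.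
apply: (@le_lt_trans _ _ (`|h| * (`|v| + `|w| + 1))).
  by rewrite ler_wpM2l // lerDl.
rewrite -ltr_pdivlMr //; near: h; apply: near0_lt.
by rewrite divr_gt0.
Unshelve. all: by end_near. Qed.

(** The increment is split at [h *: v + x]. The first leg gives the derivative along [v]; the mean
    value theorem turns the second into [h] times a derivative along [w] at a nearby point, where
    continuity applies. *)
Lemma derive_dirD f x v w : derivable f x v ->
  (\forall y \near x, derivable f y w) -> {for x, continuous (fun y => 'D_w f y)} ->
  is_derive x (v + w) f ('D_v f x + 'D_w f x).
Proof.
move=> fv fw cw; suff cv : (fun h : R =>
    h^-1 *: ((f \o shift x) (h *: (v + w)) - f x)) @ 0^' --> 'D_v f x + 'D_w f x.
  by apply: DeriveDef; [apply/cvg_ex; eexists; exact: cv|exact: cvg_lim].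
have -> : (fun h : R => h^-1 *: ((f \o shift x) (h *: (v + w)) - f x)) =
    (fun h : R => h^-1 *: ((f \o shift x) (h *: v) - f x)
     + h^-1 *: (f (h *: w + (h *: v + x)) - f (h *: v + x))).
  apply/funext => h; rewrite -scalerDr /=; congr (_ *: _).
  by rewrite scalerDr [h *: v + h *: w]addrC -addrA [RHS]addrC [RHS]addrA subrK.
apply: cvgD; first exact: fv.
apply/cvgrPdist_lt => e e0.
have /near_parallelogram - /(_ v w) near1 := fw.
have /cvgrPdist_lt /(_ e e0) /near_parallelogram - /(_ v w) near2 := cw.
rewrite /dnbhs near_withinE; apply: filterS2 near1 near2 => h h1 h2 h0.
have le01 : (0 <= 1 :> R) && (1 <= 1 :> R) by rewrite ler01 lexx.
have E s : s *: (h *: w) + (h *: v + x) = 1 *: (h *: v) + s *: (h *: w) + x.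
  by rewrite scale1r addrCA addrA.
have fhw s : 0 <= s <= 1 -> derivable f (s *: (h *: w) + (h *: v + x)) w.
  by move=> s01; rewrite E; exact: h1.
have fhw' s : 0 <= s <= 1 -> derivable f (s *: (h *: w) + (h *: v + x)) (h *: w).
  by move=> s01; have [] := derive_dirZ h (fhw s s01).
have [s s01 ->] := mvt_dir fhw'.
have [_ ->] := derive_dirZ h (fhw s s01).
by rewrite [h^-1 *: _]mulKf // E; exact: h2.
Qed.

Lemma second_difference_cvg f x v w :
  (\forall y \near x, [/\ derivable f y v & derivable (fun y => 'D_v f y) y w]) ->
  {for x, continuous (fun y => 'D_w (fun y => 'D_v f y) y)} ->
  (fun h : R => (h * h)^-1 * (f (h *: v + (h *: w + x)) - f (h *: v + x)
                        - (f (h *: w + x) - f x))) @ 0^' -->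
  'D_w (fun y => 'D_v f y) x.
Proof.
move=> fvw cvw; apply/cvgrPdist_lt => e e0.
have /near_parallelogram - /(_ v w) near1 := fvw.
have /cvgrPdist_lt /(_ e e0) /near_parallelogram - /(_ v w) near2 := cvw.
rewrite /dnbhs near_withinE; apply: filterS2 near1 near2 => h h1 h2 h0.
have le00 : (0 <= 0 :> R) && (0 <= 1 :> R) by rewrite ler01 lexx.
have le11 : (0 <= 1 :> R) && (1 <= 1 :> R) by rewrite ler01 lexx.
(* The second difference is the increment of [phi] over [h *: v]. The mean value theorem along [v]
   and then along [w] gives [h * h] times the mixed derivative at a point of the parallelogram. *)
pose phi y := f (h *: w + y) - f y.
have E1 s : s *: (h *: v) + x = s *: (h *: v) + 0 *: (h *: w) + x.
  by rewrite scale0r addr0.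
have E2 s s' : s' *: (h *: w) + (s *: (h *: v) + x)
    = s *: (h *: v) + s' *: (h *: w) + x.
  by rewrite addrCA addrA.
have dphi s : 0 <= s <= 1 -> is_derive (s *: (h *: v) + x) (h *: v) phi
   (h * ('D_v f (h *: w + (s *: (h *: v) + x)) - 'D_v f (s *: (h *: v) + x))).
  move=> s01; rewrite mulrBr; apply: is_deriveB.
    have [+ _] := h1 s 1 s01 le11; rewrite -E2 scale1r => /(derive_dirZ h).
    exact: is_derive_translate.
  have [+ _] := h1 s 0 s01 le00; rewrite -E1 => /(derive_dirZ h).
  exact.
have [|s s01] := mvt_dir (f := phi) (y := x) (v := h *: v).
  by move=> s /dphi[].
have [_ ->] := dphi s s01; rewrite /phi => Ephi.
have dD s' : 0 <= s' <= 1 ->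
    derivable (fun y => 'D_v f y) (s' *: (h *: w) + (s *: (h *: v) + x)) w.
  by move=> s'01; rewrite E2; have [] := h1 s s' s01 s'01.
have dD' s' : 0 <= s' <= 1 ->
    derivable (fun y => 'D_v f y) (s' *: (h *: w) + (s *: (h *: v) + x)) (h *: w).
  by move=> s'01; have [] := derive_dirZ h (dD s' s'01).
have [s' s'01 Es'] := mvt_dir dD'.
have [_ Ed] := derive_dirZ h (dD s' s'01).
rewrite [h *: v + (h *: w + x)]addrCA Ephi Es' Ed [h * (h * _)]mulrA.
rewrite mulKf ?mulf_neq0 //.
by rewrite E2; exact: h2.
Qed.

(** The second difference is symmetric in [v] and [w], so both mixed derivatives are its limit. *)
Lemma derive_dirC f x v w :
  (\forall y \near x, [/\ derivable f y v & derivable (fun y => 'D_v f y) y w]) ->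
  (\forall y \near x, [/\ derivable f y w & derivable (fun y => 'D_w f y) y v]) ->
  {for x, continuous (fun y => 'D_w (fun y => 'D_v f y) y)} ->
  {for x, continuous (fun y => 'D_v (fun y => 'D_w f y) y)} ->
  'D_w (fun y => 'D_v f y) x = 'D_v (fun y => 'D_w f y) x.
Proof.
move=> fvw fwv cvw cwv; apply: (cvg_unique _ (second_difference_cvg fvw cvw)).
  exact: norm_hausdorff.
have -> : (fun h : R => (h * h)^-1 * (f (h *: v + (h *: w + x)) - f (h *: v + x)
                                      - (f (h *: w + x) - f x))) =
    (fun h => (h * h)^-1 * (f (h *: w + (h *: v + x)) - f (h *: w + x)
                            - (f (h *: v + x) - f x))).
  by apply/funext => h; rewrite [h *: w + (_ + _)]addrCA; ring.
exact: second_difference_cvg.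
Qed.

End DirectionalDerivatives.

(** * The ring of smooth functions *)

Section SmoothFunctions.
Context {R : realType} {V : normedModType R} (U : set V) (U_open : open U).
Implicit Types (f g : V -> R).

Lemma open_near (P : V -> Prop) x : U x -> (forall y, U y -> P y) ->
  \forall y \near x, P y.
Proof.
move=> Ux UP; apply: (@filterS _ _ _ U); first exact: UP.
exact: open_nbhs_nbhs.
Qed.

(** Continuity and derivatives are local and [U] is open. This lets derivative formulas that hold
    only on [U] be used in inductions on [k]. *)
Lemma Ck_eq (W : normedModType R) k (f g : V -> W) :
  (forall x, U x -> f x = g x) -> Ck k U f -> Ck k U g.
Proof.
have gc (f1 g1 : V -> W) x : (forall x, U x -> f1 x = g1 x) -> U x ->
    {for x, continuous f1} -> {for x, continuous g1}.
  move=> fg Ux fc; suff : g1 y @[y --> x] --> g1 x by [].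
  have {}fc : f1 y @[y --> x] --> f1 x by exact: fc.
  rewrite -(fg x Ux); apply: cvg_trans fc; apply: near_eq_cvg.
  exact: open_near.
elim: k f g => [|k IH] f g fg /= [fc fd].
  by split=> // x Ux; exact: gc (fc x Ux).
split=> [x Ux|v]; first exact: gc (fc x Ux).
have [fv fk] := fd v; split.
  by move=> x Ux; apply: near_eq_derivable (fv x Ux); exact: open_near.
apply: IH fk => x Ux; apply: near_eq_derive; exact: open_near.
Qed.

Lemma CkS (W : normedModType R) k (f : V -> W) : Ck k.+1 U f -> Ck k U f.
Proof.
elim: k f => [|k IH] f [fc fd]; split=> // v.
by have [fv fk] := fd v; split=> //; exact: IH.
Qed.

Lemma Ck_cst k (a : R) : Ck k U (fun=> a).
Proof.
elim: k a => [|k IH] a; (split; first by move=> x _; exact: cvg_cst) => //= v.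
split=> [x _|]; first exact: derivable_cst.
by apply: Ck_eq (IH 0) => x _; rewrite derive_cst.
Qed.

Lemma CkD k f g : Ck k U f -> Ck k U g -> Ck k U (fun x => f x + g x).
Proof.
elim: k f g => [|k IH] f g [fc fd] [gc gd];
  (split; first by move=> x Ux; apply: cvgD; [exact: fc|exact: gc]) => //= v.
have [fv fk] := fd v; have [gv gk] := gd v; split=> [x Ux|].
  by apply: derivableD; [exact: fv|exact: gv].
apply: Ck_eq (IH _ _ fk gk) => x Ux.
by rewrite deriveD; [|exact: fv|exact: gv].
Qed.

Lemma CkM k f g : Ck k U f -> Ck k U g -> Ck k U (fun x => f x * g x).
Proof.
elim: k f g => [|k IH] f g fS gS; have [fc fd] := fS; have [gc gd] := gS;
  (split; first by move=> x Ux; apply: cvgM; [exact: fc|exact: gc]) => //= v.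
have [fv fk] := fd v; have [gv gk] := gd v; split=> [x Ux|].
  by apply: derivableM; [exact: fv|exact: gv].
apply: Ck_eq (CkD (IH _ _ (CkS fS) gk) (IH _ _ (CkS gS) fk)) => x Ux.
by rewrite deriveM; [|exact: fv|exact: gv].
Qed.

Lemma CkN k f : Ck k U f -> Ck k U (fun x => - f x).
Proof.
move=> fS; apply: Ck_eq (CkM (Ck_cst k (-1)) fS) => x Ux.
by rewrite mulN1r.
Qed.

Lemma CkV k f : (forall x, U x -> f x != 0) -> Ck k U f ->
  Ck k U (fun x => (f x)^-1).
Proof.
move=> f0; elim: k => [|k IH] fS; have [fc fd] := fS;
  (split; first by move=> x Ux; apply: cvgV; [exact: f0|exact: fc]) => //= v.
have [fv fk] := fd v; split=> [x Ux|].
  by apply: derivableV; [exact: f0|exact: fv].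
have IHk := IH (CkS fS).
apply: Ck_eq (CkN (CkM (CkM IHk IHk) fk)) => x Ux.
rewrite deriveV; [|exact: f0|exact: fv].
by rewrite expr2 invfM -mulNr.
Qed.

Lemma Ck_sum k (I : Type) (r : seq I) (P : pred I) (F : I -> V -> R) :
  (forall i, Ck k U (F i)) -> Ck k U (fun x => \sum_(i <- r | P i) F i x).
Proof.
move=> FS; elim: r => [|i r IH].
  by apply: Ck_eq (Ck_cst k 0) => x _; rewrite big_nil.
case Pi: (P i); last by apply: Ck_eq IH => x _; rewrite big_cons Pi.
by apply: Ck_eq (CkD (FS i) IH) => x _; rewrite big_cons Pi.
Qed.

Lemma Ck_prod k (I : Type) (r : seq I) (P : pred I) (F : I -> V -> R) :
  (forall i, Ck k U (F i)) -> Ck k U (fun x => \prod_(i <- r | P i) F i x).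
Proof.
move=> FS; elim: r => [|i r IH].
  by apply: Ck_eq (Ck_cst k 1) => x _; rewrite big_nil.
case Pi: (P i); last by apply: Ck_eq IH => x _; rewrite big_cons Pi.
by apply: Ck_eq (CkM (FS i) IH) => x _; rewrite big_cons Pi.
Qed.

Lemma Ck_det k m (M : V -> 'M[R]_m) :
  (forall i j, Ck k U (fun x => M x i j)) -> Ck k U (fun x => \det (M x)).
Proof.
move=> MS; apply: Ck_sum => s; apply: CkM; first exact: Ck_cst.
by apply: Ck_prod => i; exact: MS.
Qed.

(** Cramer's rule: an entry of the inverse is a signed minor divided by the determinant. *)
Lemma Ck_invmx k m (M : V -> 'M[R]_m) i j : (forall x, U x -> M x \in unitmx) ->
  (forall i j, Ck k U (fun x => M x i j)) -> Ck k U (fun x => invmx (M x) i j).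
Proof.
move=> Mu MS; have detS := CkV _ (Ck_det MS).
apply: Ck_eq (CkM (detS _) (CkM (Ck_cst k ((-1) ^+ (j + i)))
    (Ck_det (M := fun x => row' j (col' i (M x))) _))) => [x Ux|x Ux|p q].
- by rewrite /invmx Mu // !mxE.
- by rewrite -unitfE; exact: Mu.
by apply: Ck_eq (MS (lift j p) (lift i q)) => x _; rewrite !mxE.
Qed.

Lemma Ck_mx_coord k m n (M : V -> 'M[R]_(m, n)) i j :
  Ck k U M -> Ck k U (fun x => M x i j).
Proof.
have Mc (F : V -> 'M[R]_(m, n)) x : {for x, continuous F} ->
    {for x, continuous (fun x => F x i j)}.
  move=> Fx.
  exact: (continuous_comp (g := fun N : 'M[R]_(m, n) => N i j) Fx
            (@coord_continuous R m n i j (F x))).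
elim: k M => [|k IH] M [Mx Md]; (split; first by move=> x Ux; apply: Mc; exact: Mx) => //= v.
have [Mv Mk] := Md v; split=> [x Ux|].
  by have /derivable_mxP := Mv x Ux; exact.
by apply: Ck_eq (IH _ Mk) => x Ux; rewrite (derive_mx (Mv x Ux)) mxE.
Qed.

End SmoothFunctions.

(* Functions are normalized to vanish off the open set, so that equality in the
   ring is Leibniz equality; the point of [U] makes the ring nontrivial. *)
Record smooth_ring (R : realType) (V : normedModType R) (U : set V)
    (U_open : open U) (p0 : V) (Up0 : U p0) := SmoothRing {
  smooth_val :> V -> R;
  smooth_valP : smooth_on U smooth_val;
  smooth_val_off : forall p, ~ U p -> smooth_val p = 0
}.

Section SmoothRing.
Context {R : realType} {V : normedModType R} {U : set V} {U_open : open U}.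
Context {p0 : V} {Up0 : U p0}.
Local Notation A := (smooth_ring U_open Up0).

HB.instance Definition _ := gen_eqMixin A.
HB.instance Definition _ := gen_choiceMixin A.

Lemma smooth_ring_eq (a b : A) : (forall p, U p -> a p = b p) -> a = b.
Proof.
case: a b => [f fS f0] [g gS g0] /= fg.
have E : f = g.
  by apply/funext => p; have [/fg //|Up] := pselect (U p); rewrite f0 // g0.
by case: _ / E in gS g0 *; congr SmoothRing; exact: Prop_irrelevance.
Qed.

Lemma smooth_restrict_subproof (f : V -> R) (fS : smooth_on U f) :
  smooth_on U (f \_ U) /\ forall p, ~ U p -> (f \_ U) p = 0.
Proof.
split=> [k|p Up]; last by rewrite patchE memNset.
by apply: (Ck_eq U_open) (fS k) => p Up; rewrite patchE mem_set.
Qed.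

Definition smooth_restrict (f : V -> R) (fS : smooth_on U f) : A :=
  SmoothRing U_open Up0 (smooth_restrict_subproof fS).1
    (smooth_restrict_subproof fS).2.

Lemma smooth_restrictE f (fS : smooth_on U f) p :
  U p -> smooth_restrict fS p = f p.
Proof. by move=> Up; rewrite /= patchE mem_set. Qed.

Let add_smooth (a b : A) : smooth_on U (fun p => a p + b p).
Proof. by move=> k; apply: CkD => //; exact: smooth_valP. Qed.

Let mul_smooth (a b : A) : smooth_on U (fun p => a p * b p).
Proof. by move=> k; apply: CkM => //; exact: smooth_valP. Qed.

Let opp_smooth (a : A) : smooth_on U (fun p => - a p).
Proof. by move=> k; apply: CkN => //; exact: smooth_valP. Qed.

Lemma cst_smooth (r : R) : smooth_on U (fun=> r).
Proof. by move=> k; exact: Ck_cst. Qed.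

Let add (a b : A) : A := smooth_restrict (add_smooth a b).
Let mul (a b : A) : A := smooth_restrict (mul_smooth a b).
Let opp (a : A) : A := smooth_restrict (opp_smooth a).
Definition smooth_cst (r : R) : A := smooth_restrict (cst_smooth r).

Let addA : associative add.
Proof.
by move=> a b c; apply: smooth_ring_eq => p Up; rewrite !smooth_restrictE // addrA.
Qed.

Let addC : commutative add.
Proof.
by move=> a b; apply: smooth_ring_eq => p Up; rewrite !smooth_restrictE // addrC.
Qed.

Let add0 : left_id (smooth_cst 0) add.
Proof.
by move=> a; apply: smooth_ring_eq => p Up; rewrite !smooth_restrictE // add0r.
Qed.

Let addN : left_inverse (smooth_cst 0) opp add.
Proof.
by move=> a; apply: smooth_ring_eq => p Up; rewrite !smooth_restrictE // addNr.
Qed.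

HB.instance Definition _ := GRing.isZmodule.Build A addA addC add0 addN.

Let mulA : associative mul.
Proof.
by move=> a b c; apply: smooth_ring_eq => p Up; rewrite !smooth_restrictE // mulrA.
Qed.

Let mulC : commutative mul.
Proof.
by move=> a b; apply: smooth_ring_eq => p Up; rewrite !smooth_restrictE // mulrC.
Qed.

Let mul1 : left_id (smooth_cst 1) mul.
Proof.
by move=> a; apply: smooth_ring_eq => p Up; rewrite !smooth_restrictE // mul1r.
Qed.

Let mulDl : left_distributive mul +%R.
Proof.
by move=> a b c; apply: smooth_ring_eq => p Up; rewrite !smooth_restrictE // mulrDl.
Qed.

Let one_neq0 : smooth_cst 1 != 0.
Proof.
apply/eqP => /(congr1 (fun a : A => a p0)); rewrite !smooth_restrictE //.
by apply/eqP; exact: oner_neq0.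
Qed.

HB.instance Definition _ :=
  GRing.Zmodule_isComNzRing.Build A mulA mulC mul1 mulDl one_neq0.

Section Evaluation.
Context (p : V) (Up : U p).

Lemma smooth_addE (a b : A) : (a + b) p = a p + b p.
Proof. exact: smooth_restrictE. Qed.

Lemma smooth_mulE (a b : A) : (a * b) p = a p * b p.
Proof. exact: smooth_restrictE. Qed.

Lemma smooth_oppE (a : A) : (- a) p = - a p.
Proof. exact: smooth_restrictE. Qed.

Lemma smooth_cstE r : smooth_cst r p = r.
Proof. exact: smooth_restrictE. Qed.

Lemma smooth_zeroE : (0 : A) p = 0.
Proof. exact: smooth_restrictE. Qed.

Lemma smooth_oneE : (1 : A) p = 1.
Proof. exact: smooth_restrictE. Qed.

Lemma smooth_sumE (I : Type) (r : seq I) (P : pred I) (F : I -> A) :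
  (\sum_(i <- r | P i) F i) p = \sum_(i <- r | P i) F i p.
Proof. exact: (big_morph (fun a : A => a p) smooth_addE smooth_zeroE). Qed.

End Evaluation.

Lemma smooth_derivable (a : A) p v : U p -> derivable a p v.
Proof. by move=> Up; have [_ /(_ v)[av _]] := smooth_valP a 1; exact: av. Qed.

Arguments smooth_derivable a {p} v _ : rename.

Lemma smooth_derive_subproof (a : A) v : smooth_on U (fun p => 'D_v a p).
Proof. by move=> k; have [_ /(_ v)[_ av]] := smooth_valP a k.+1. Qed.

Definition smooth_derive (v : V) (a : A) : A :=
  smooth_restrict (smooth_derive_subproof a v).

Lemma smooth_deriveE v (a : A) p : U p -> smooth_derive v a p = 'D_v a p.
Proof. exact: smooth_restrictE. Qed.

Lemma smooth_derive_derivation v : derivation (smooth_derive v).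
Proof.
split=> a b; apply: smooth_ring_eq => p Up.
  rewrite smooth_addE // !smooth_deriveE //.
  rewrite -(deriveD (smooth_derivable a v Up) (smooth_derivable b v Up)).
  by apply: near_eq_derive; apply: (open_near U_open) => // q Uq; exact: smooth_addE.
rewrite smooth_addE // !smooth_mulE // !smooth_deriveE // addrC.
have := deriveM (smooth_derivable a v Up) (smooth_derivable b v Up).
rewrite [b p *: _]mulrC => <-.
by apply: near_eq_derive; apply: (open_near U_open) => // q Uq; exact: smooth_mulE.
Qed.

Lemma near_smooth_derive v (a : A) p : U p ->
  \forall q \near p, smooth_derive v a q = 'D_v a q.
Proof. by move=> Up; apply: (open_near U_open) => // q Uq; exact: smooth_deriveE. Qed.

Lemma smooth_deriveC v w (a : A) :
  smooth_derive v (smooth_derive w a) = smooth_derive w (smooth_derive v a).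
Proof.
apply: smooth_ring_eq => p Up.
rewrite (smooth_deriveE v _ Up) (smooth_deriveE w _ Up).
rewrite (near_eq_derive _ (near_smooth_derive w a Up)).
rewrite (near_eq_derive _ (near_smooth_derive v a Up)).
have D u u' q : U q ->
    [/\ derivable a q u & derivable (fun q => 'D_u a q) q u'].
  move=> Uq; split; first exact: smooth_derivable.
  by have [_ /(_ u')[au _]] := smooth_derive_subproof a u 1; exact: au.
have C u u' : {for p, continuous (fun q => 'D_u' (fun q => 'D_u a q) q)}.
  by have [_ /(_ u')[_ [Duu _]]] := smooth_derive_subproof a u 1; exact: Duu.
by apply: derive_dirC => //; apply: (open_near U_open) => // q Uq; exact: D.
Qed.

Lemma derive_smooth_linear (I : Type) (r : seq I) (c : I -> R) (v : I -> V)
    (a : A) p : U p ->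
  'D_(\sum_(i <- r) c i *: v i) a p = \sum_(i <- r) c i * 'D_(v i) a p.
Proof.
move=> Up; elim: r => [|i r IH]; first by rewrite !big_nil derive0.
rewrite !big_cons -{}IH; move: (\sum_(j <- r) c j *: v j) => w.
have [dZ <-] := derive_dirZ (c i) (smooth_derivable a (v i) Up).
have near_w : \forall q \near p, derivable a q w.
  by apply: (open_near U_open Up) => q Uq; exact: (smooth_derivable a w Uq).
have cont_w : {for p, continuous (fun q => 'D_w a q)}.
  by have [_ /(_ w)[_ [Da _]]] := smooth_valP a 1; exact: Da.
by have [_ ->] := derive_dirD dZ near_w cont_w.
Qed.

End SmoothRing.

(** * Tensor fields in a chart *)

Section SpaceTime.
Context {R : realType} {m : nat} (J : set R) (O : set 'rV[R]_m).
Context (J_open : open J) (O_open : open O).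

Lemma space_time_open : open (J `*` O).
Proof.
rewrite openE => -[t x] [/= Jt Ox].
by exists (J, O) => //; split; exact: open_nbhs_nbhs.
Qed.

Context (t0 : R) (x0 : 'rV[R]_m) (tx0 : (J `*` O) (t0, x0)).
Local Notation A := (smooth_ring space_time_open tx0).
Local Notation e i := (@delta_mx A 1 m 0 i).

Definition space_dir (v : 'rV[R]_m) : R * 'rV[R]_m := (0, v).
Definition space_derive (i : 'I_m) : A -> A :=
  smooth_derive (space_dir (delta_mx 0 i)).
Definition time_dir : R * 'rV[R]_m := (1, 0).
Definition time_derive : A -> A := smooth_derive time_dir.

Context (s : R) (Js : J s).

(** Elements of [A] live on space-time, whereas the coordinate definitions see one metric at one
    time; the link is restriction to the slice at time [s], on [O] only. *)
Definition represents (f : 'rV[R]_m -> R) (a : A) : Prop :=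
  forall y, O y -> f y = a (s, y).

Definition represents_field (X : @vfield R m) (xi : 'rV[A]_m) : Prop :=
  forall i, represents (fun y => X y 0 i) (xi 0 i).

(** A logical relation: represented arguments give represented values. Tensors on unrestricted
    functions can thus be compared with tensors on row vectors over [A], and the relation is
    preserved by covariant differentiation. *)
Definition represents2 (T : @tensor2 R m) tau : Prop :=
  forall X Y xi eta, represents_field X xi -> represents_field Y eta ->
  represents (T X Y) (tau xi eta).

Definition represents4 (T : @tensor4 R m) tau : Prop :=
  forall X Y Z W xi eta zeta om, represents_field X xi ->
  represents_field Y eta -> represents_field Z zeta -> represents_field W om ->
  represents (T X Y Z W) (tau xi eta zeta om).

Let stO y : O y -> (J `*` O) (s, y). Proof. by []. Qed.

Lemma representsD f g a b : represents f a -> represents g b ->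
  represents (fun y => f y + g y) (a + b).
Proof.
by move=> fa gb y Oy; rewrite smooth_addE ?fa ?gb //; exact: stO.
Qed.

Lemma representsN f a : represents f a -> represents (fun y => - f y) (- a).
Proof. by move=> fa y Oy; rewrite smooth_oppE ?fa //; exact: stO. Qed.

Lemma representsM f g a b : represents f a -> represents g b ->
  represents (fun y => f y * g y) (a * b).
Proof.
by move=> fa gb y Oy; rewrite smooth_mulE ?fa ?gb //; exact: stO.
Qed.

Lemma represents_sum (I : Type) (r : seq I) (P : pred I) F (F' : I -> A) :
  (forall i, represents (F i) (F' i)) ->
  represents (fun y => \sum_(i <- r | P i) F i y) (\sum_(i <- r | P i) F' i).
Proof.
move=> FF y Oy; rewrite smooth_sumE; last exact: stO.
by apply: eq_bigr => i _; exact: FF.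
Qed.

Lemma represents_coord i : represents_field (coord_field i) (e i).
Proof.
move=> j y Oy; rewrite !mxE !eqxx /=; case: (j == i).
  by rewrite mulr1n smooth_oneE //; exact: stO.
by rewrite mulr0n smooth_zeroE //; exact: stO.
Qed.

Lemma derive_space (a : A) v y :
  'D_v (fun y => a (s, y)) y = 'D_(space_dir v) a (s, y).
Proof.
have E : (fun h : R =>
      h^-1 *: (((fun y => a (s, y)) \o shift y) (h *: v) - a (s, y))) =
    (fun h : R =>
      h^-1 *: ((a \o shift (s, y)) (h *: space_dir v) - a (s, y))).
  apply/funext => h; congr (_ *: (a _ - _)).
  by congr pair; rewrite /= scaler0 add0r.
by rewrite /derive E.
Qed.

Lemma represents_deriv X f xi a : represents_field X xi -> represents f a ->
  represents (deriv_along X f) (der_along space_derive xi a).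
Proof.
move=> Xxi fa y Oy; rewrite /deriv_along.
have -> : 'D_(X y) f y = 'D_(X y) (fun y => a (s, y)) y.
  by apply: near_eq_derive; apply: (open_near O_open Oy).
rewrite derive_space /der_along smooth_sumE; last exact: stO.
(* The definition differentiates in the single direction [X y], the algebra sums over coordinate
   directions; smoothness of [a] makes the two agree. *)
have -> : space_dir (X y) = \sum_i (X y) 0 i *: space_dir (delta_mx 0 i).
  rewrite [in LHS](row_sum_delta (X y)) /space_dir.
  elim/big_rec2: _ => // i [u1 u2] v _ [<- <-].
  by congr pair => //=; rewrite scaler0 add0r.
rewrite derive_smooth_linear; last exact: stO.
apply: eq_bigr => i _; rewrite smooth_mulE; last exact: stO.
by rewrite smooth_deriveE ?Xxi //; exact: stO.
Qed.

Context (G : 'rV[R]_m -> 'M[R]_m) (Gs Hs : 'M[A]_m).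
Context (GE : forall i j, represents (fun y => G y i j) (Gs i j)).
Context (HE : forall i j, represents (fun y => invmx (G y) i j) (Hs i j)).
Context (half : A) (halfE : represents (fun=> 2^-1) half).

Local Notation Gam := (metric_conn space_derive Gs Hs half).

Lemma represents_christoffel k i j :
  represents (christoffel G k i j) (Gam k i j).
Proof.
have D i' j' k' := represents_deriv (represents_coord i') (GE j' k').
have := fun l => representsM (HE k l)
  (representsD (representsD (D i j l) (D j i l)) (representsN (D l i j))).
move/represents_sum => /(_ (index_enum _) xpredT) /(representsM halfE) E y Oy.
rewrite [LHS](E y Oy) !smooth_mulE; do ?exact: stO; congr (_ * _).
rewrite !smooth_sumE; do ?exact: stO.
apply: eq_bigr => l _; rewrite !smooth_mulE; do ?exact: stO.
by rewrite !der_along_coord.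
Qed.

Lemma represents_inner X Y xi eta : represents_field X xi ->
  represents_field Y eta -> represents (inner G X Y) (scalar_prod Gs xi eta).
Proof.
move=> Xxi Yeta y Oy; rewrite /inner /scalar_prod !mxE smooth_sumE; last exact: stO.
apply: eq_bigr => j _; rewrite smooth_mulE; last exact: stO.
rewrite !mxE (Yeta j y Oy) smooth_sumE; last exact: stO.
congr (_ * _); apply: eq_bigr => i _; rewrite smooth_mulE; last exact: stO.
by rewrite (Xxi i y Oy) (GE i j Oy).
Qed.

Lemma represents_nabla X Y xi eta : represents_field X xi ->
  represents_field Y eta ->
  represents_field (nabla G X Y) (conn space_derive Gam xi eta).
Proof.
move=> Xxi Yeta k; have := representsD (represents_deriv Xxi (Yeta k))
  (represents_sum (index_enum _) xpredT (fun i =>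
     represents_sum (index_enum _) xpredT (fun j =>
       representsM (representsM (represents_christoffel k i j) (Xxi i)) (Yeta j)))).
by move=> E y Oy; rewrite !mxE [LHS](E y Oy).
Qed.

Lemma represents_bracket X Y xi eta : represents_field X xi ->
  represents_field Y eta ->
  represents_field (lie_bracket X Y) (bracket space_derive xi eta).
Proof.
move=> Xxi Yeta k; have := representsD (represents_deriv Xxi (Yeta k))
  (representsN (represents_deriv Yeta (Xxi k))).
by move=> E y Oy; rewrite !mxE [LHS](E y Oy).
Qed.

Lemma represents_fieldD X Y xi eta : represents_field X xi ->
  represents_field Y eta -> represents_field (fun y => X y + Y y) (xi + eta).
Proof.
by move=> Xxi Yeta k y Oy; rewrite !mxE; exact: (representsD (Xxi k) (Yeta k)).
Qed.

Lemma represents_fieldN X xi : represents_field X xi ->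
  represents_field (fun y => - X y) (- xi).
Proof. by move=> Xxi k y Oy; rewrite !mxE; exact: (representsN (Xxi k)). Qed.

Lemma represents_curv : represents4 (curv G) (curv_form space_derive Gam Gs).
Proof.
move=> X Y Z W xi eta zeta om Xxi Yeta Zzeta Wom.
apply: represents_inner => //; apply: represents_fieldD; last first.
  exact: represents_nabla (represents_bracket Xxi Yeta) Zzeta.
apply: (represents_fieldD (represents_nabla _ _) (represents_fieldN _)) => //;
  by do ?apply: represents_nabla.
Qed.

Lemma represents_nabla2 X T xi tau : represents_field X xi -> represents2 T tau ->
  represents2 (nabla_tensor2 G X T) (conn2 space_derive Gam xi tau).
Proof.
move=> Xxi TT Y Z eta zeta Yeta Zzeta.
have N U u := represents_nabla (Y := U) (eta := u) Xxi.
have D := represents_deriv Xxi (TT _ _ _ _ Yeta Zzeta).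
have D1 := representsN (TT _ _ _ _ (N _ _ Yeta) Zzeta).
have D2 := representsN (TT _ _ _ _ Yeta (N _ _ Zzeta)).
exact: (representsD (representsD D D1) D2).
Qed.

Lemma represents_nabla4 X T xi tau : represents_field X xi -> represents4 T tau ->
  represents4 (nabla_tensor4 G X T) (conn4 space_derive Gam xi tau).
Proof.
move=> Xxi TT Y Z U W eta zeta ups om Yeta Zzeta Uups Wom.
have N V v := represents_nabla (Y := V) (eta := v) Xxi.
have D := represents_deriv Xxi (TT _ _ _ _ _ _ _ _ Yeta Zzeta Uups Wom).
have D1 := representsN (TT _ _ _ _ _ _ _ _ (N _ _ Yeta) Zzeta Uups Wom).
have D2 := representsN (TT _ _ _ _ _ _ _ _ Yeta (N _ _ Zzeta) Uups Wom).
have D3 := representsN (TT _ _ _ _ _ _ _ _ Yeta Zzeta (N _ _ Uups) Wom).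
have D4 := representsN (TT _ _ _ _ _ _ _ _ Yeta Zzeta Uups (N _ _ Wom)).
exact: (representsD (representsD (representsD (representsD D D1) D2) D3) D4).
Qed.

Lemma represents_hess2 X Y T xi eta tau : represents_field X xi ->
  represents_field Y eta -> represents2 T tau ->
  represents2 (nabla2_tensor2 G X Y T) (hess2 space_derive Gam xi eta tau).
Proof.
move=> Xxi Yeta TT Z U zeta ups Zzeta Uups.
have D := represents_nabla2 Xxi (represents_nabla2 Yeta TT) Zzeta Uups.
have D1 := represents_nabla2 (represents_nabla Xxi Yeta) TT Zzeta Uups.
exact: (representsD D (representsN D1)).
Qed.

Lemma represents_hess4 X Y T xi eta tau : represents_field X xi ->
  represents_field Y eta -> represents4 T tau ->
  represents4 (nabla2_tensor4 G X Y T) (hess4 space_derive Gam xi eta tau).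
Proof.
move=> Xxi Yeta TT Z U W S zeta ups om sig Zzeta Uups Wom Ssig.
have D := represents_nabla4 Xxi (represents_nabla4 Yeta TT) Zzeta Uups Wom Ssig.
have D1 := represents_nabla4 (represents_nabla Xxi Yeta) TT Zzeta Uups Wom Ssig.
exact: (representsD D (representsN D1)).
Qed.

End SpaceTime.

(** * The evolution equation in an adapted chart *)

Lemma posdef_unitmx (R : realFieldType) (m : nat) (G : 'M[R]_m) :
  (forall v : 'rV[R]_m, v != 0 -> 0 < (v *m G *m v^T) 0 0) -> G \in unitmx.
Proof.
move=> Gpos; rewrite -row_free_unit -kermx_eq0; apply/negPn/rowV0Pn => -[v].
by move=> /sub_kermxP vG /Gpos; rewrite vG mul0mx mxE ltxx.
Qed.

Lemma is_derive_time (R : realType) (W : normedModType R) (a : R * W -> R) t x :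
  derivable a (t, x) (1, 0) ->
  is_derive t (1 : R) (fun s => a (s, x)) ('D_(1, 0) a (t, x)).
Proof.
have E s : s *: (1, 0) + (0, x) = (s, x) :> R * W.
  by congr pair; rewrite /= ?scaler0 ?add0r // addr0 [_ *: _]mulr1.
move=> ad; have := @is_derive_line R (R * W)%type a (0, x) (1, 0) t.
rewrite E => /(_ ad); congr (is_derive _ _ _ _).
by apply/funext => s; rewrite E.
Qed.

Theorem proposition5 (R : realType) (n : nat) (M : smooth_manifold R n.+1)
    (N : vector_components M) (J : set R) (g : R -> metric_components M)
    (J_open : open J)
    (g_metric : is_metric_evolution J g)
    (N_field : is_vector_field N)
    (N_unit : forall t, J t -> is_unit_for (g t) N)
    (g_flow : is_partial_ricci_flow N J g)
    (c : chart R n.+1 M) (c_adapted : is_adapted N J g c)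
    (t : R) (x : 'rV[R]_n.+1) (Jt : J t) (cx : img c x)
    (i j k l : 'I_n.+1) :
  let G := g t c in
  let Rm i j k l := components4 (curv G) i j k l x in
  let r i j := components2 (partial_ricci G (N c)) i j x in
  let B i j k l := quad_curv G i j k l x in
  let Q i k j l := hess_defect G (N c) i k j l x in
  is_derive t 1 (fun s => components4 (curv (g s c)) i j k l x)
    (components4 (nabla2_tensor4 G (N c) (N c) (curv G)) i j k l x
     + B i j k l - B i j l k - B j i k l + B j i l k
     - 2 * B k j l i + 2 * B k i l j
     - \sum_p \sum_q invmx (G x) p q *
         (Rm q j k l * r i p + Rm i q k l * r j p
          + Rm i j q l * r k p + Rm i j k q * r l p)
     - (Q i k j l - Q i l j k - Q j k i l + Q j l i k)).
Proof.
move=> G Rm r B Q; have [c_atlas NcE _] := c_adapted.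
have [g_riem gS] := g_metric; have {}gS := gS c c_atlas.
pose O := img c; have O_open : open O by exact: img_open.
have tx : (J `*` O) (t, x) by [].
pose A := smooth_ring (space_time_open J_open O_open) tx.
have G_unit p : (J `*` O) p -> g p.1 c p.2 \in unitmx.
  move=> [Js Oy]; have [_ _ Gpos _] := g_riem _ Js.
  by apply: posdef_unitmx; exact: Gpos.
have G_coord (a b : 'I_n.+1) : smooth_on (J `*` O) (fun p => g p.1 c p.2 a b).
  by move=> q; apply: Ck_mx_coord; [exact: space_time_open|exact: gS].
have H_coord (a b : 'I_n.+1) :
    smooth_on (J `*` O) (fun p => invmx (g p.1 c p.2) a b).
  move=> q; apply: Ck_invmx => // [|a' b']; first exact: space_time_open.
  exact: G_coord.
(* One matrix over the ring represents the metrics of all times in [J] at once, so the time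
   derivative can be taken inside the ring. *)
pose Gs : 'M[A]_n.+1 := \matrix_(a, b) smooth_restrict (G_coord a b).
pose Hs : 'M[A]_n.+1 := \matrix_(a, b) smooth_restrict (H_coord a b).
pose half : A := smooth_cst 2^-1.
have GE s : J s -> forall a b, represents s (fun y => g s c y a b) (Gs a b).
  by move=> Js a b y Oy; rewrite mxE smooth_restrictE.
have HE s : J s -> forall a b, represents s (fun y => invmx (g s c y) a b) (Hs a b).
  by move=> Js a b y Oy; rewrite mxE smooth_restrictE.
have halfE s : J s -> represents s (fun=> 2^-1) half.
  by move=> Js y Oy; rewrite smooth_cstE.
have half2 : half * 2 = 1.
  apply: smooth_ring_eq => p Up.
  by rewrite mulr2n mulrDr !mulr1 smooth_addE // !smooth_cstE //; lra.
have GsT : Gs^T = Gs.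
  apply/matrixP => a b; rewrite !mxE; apply: smooth_ring_eq => -[s y] [Js Oy].
  rewrite !smooth_restrictE //; have [_ GT _ _] := g_riem _ Js.
  by rewrite -[in LHS](GT c y) // mxE.
have GsH : Gs *m Hs = 1%:M.
  apply/matrixP => a b; rewrite !mxE; apply: smooth_ring_eq => -[s y] [Js Oy].
  have := congr1 (fun K : 'M[R]_n.+1 => K a b) (mulmxV (G_unit (s, y) (conj Js Oy))).
  rewrite !mxE smooth_sumE // => E; transitivity ((a == b)%:R : R).
    by rewrite -E; apply: eq_bigr => q _; rewrite !mxE smooth_mulE // !smooth_restrictE.
  by case: (a == b); rewrite ?mulr1n ?mulr0n ?smooth_oneE ?smooth_zeroE.
pose d : 'I_n.+1 -> A -> A := @space_derive _ _ _ _ J_open O_open t x tx.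
pose Gam := metric_conn d Gs Hs half.
pose Ra := curv_form d Gam Gs.
pose e q := @delta_mx A 1 n.+1 0 q.
have dP q : derivation (d q) by exact: smooth_derive_derivation.
have dC p q (a : A) : d p (d q a) = d q (d p a) by exact: smooth_deriveC.
have RE s (Js : J s) : represents4 s (curv (g s c)) Ra.
  exact: (represents_curv Js (GE s Js) (HE s Js) (halfE s Js)).
have eE s (Js : J s) q : represents_field s (coord_field q) (e q).
  exact: represents_coord.
(* Adaptedness of the chart enters here: [N] becomes the basis vector of index 0, both in the
   partial Ricci curvature and in the second derivative along [N]. *)
have NE s (Js : J s) : represents_field s (N c) (e ord0).
  by move=> q y Oy; rewrite NcE //; exact: (eE s Js).
have rE s (Js : J s) : represents2 s (partial_ricci (g s c) (N c))
    (fun X Y => Ra X (e ord0) Y (e ord0)).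
  move=> X Y xi eta Xxi Yeta; have Ns := NE s Js.
  exact: (RE s Js).
(* The flow equation at every time and point of the chart amounts to one equality in the ring. *)
have flow a b : time_derive (Gs a b) = - 2 * Ra (e a) (e ord0) (e b) (e ord0).
  apply: smooth_ring_eq => -[s y] [Js Oy].
  have [_ D] := g_flow s c y a b Js c_atlas Oy.
  rewrite smooth_deriveE // smooth_mulE // smooth_oppE // mulr2n.
  rewrite smooth_addE // smooth_oneE // -(rE s Js _ _ _ _ (eE s Js a) (eE s Js b)) //.
  rewrite -[RHS]D.
  have /is_derive_time[_ <-] :
      derivable (Gs a b) (s, y) ((1, 0) : R * 'rV[R]_n.+1).
    by apply: smooth_derivable; split.
  apply: near_eq_derive; apply: (open_near J_open Js) => s' Js'.
  by rewrite (GE s' Js').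
have GamC q a b : Gam q a b = Gam q b a by exact: metric_connC.
have compat a b q : d a (Gs b q) =
    \sum_p Gam p a b * Gs p q + \sum_p Gam p a q * Gs b p.
  exact: metric_conn_compat.
have evo := curv_form_evolution dP dC GsT GsH GamC compat half2 i j k l
  (smooth_derive_derivation _) (fun q a => smooth_deriveC _ _ a) flow.
have RmE s (Js : J s) a b p q : components4 (curv (g s c)) a b p q x =
    Ra (e a) (e b) (e p) (e q) (s, x).
  exact: (RE s Js _ _ _ _ _ _ _ _ (eE s Js a) (eE s Js b) (eE s Js p) (eE s Js q)).
(* Since [J] is open, near [t] the curvature component is the restriction of one ring element to the
   line through [x], so its derivative is a value of [time_derive]. *)
apply: (near_eq_is_derive (f := fun s => Ra (e i) (e j) (e k) (e l) (s, x))).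
  by apply: (open_near J_open Jt) => s Js; rewrite RmE.
apply: is_derive_eq.
  apply: (is_derive_time (a := Ra (e i) (e j) (e k) (e l))).
  by apply: smooth_derivable; split.
transitivity (time_derive (Ra (e i) (e j) (e k) (e l)) (t, x)).
  by rewrite smooth_deriveE.
apply: etrans (congr1 (fun a : A => a (t, x)) evo) _ => {evo}.
(* Evaluation at [(t, x)] respects the ring operations, so the algebraic identity can be matched
   with the goal term by term. *)
have evD (a b : A) (r1 r2 : R) : a (t, x) = r1 -> b (t, x) = r2 ->
    (a + b) (t, x) = r1 + r2 by move=> <- <-; rewrite smooth_addE.
have evN (a : A) (r1 : R) : a (t, x) = r1 -> (- a) (t, x) = - r1.
  by move=> <-; rewrite smooth_oppE.
have evB (a b : A) (r1 r2 : R) : a (t, x) = r1 -> b (t, x) = r2 ->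
    (a - b) (t, x) = r1 - r2 by move=> aE bE; apply: (evD) => //; exact: evN.
have evM (a b : A) (r1 r2 : R) : a (t, x) = r1 -> b (t, x) = r2 ->
    (a * b) (t, x) = r1 * r2 by move=> <- <-; rewrite smooth_mulE.
have ev2 : (2 : A) (t, x) = 2 by apply: (evD); rewrite smooth_oneE.
have {RmE}Rmt a b p q : Ra (e a) (e b) (e p) (e q) (t, x) = Rm a b p q.
  by rewrite -RmE.
have rt a b : Ra (e a) (e ord0) (e b) (e ord0) (t, x) = r a b.
  by rewrite -(rE t Jt _ _ _ _ (eE t Jt a) (eE t Jt b)).
have Bt a b p q : quad_form Hs (fun a b p q => Ra (e a) (e b) (e p) (e q)) ord0
    a b p q (t, x) = B a b p q.
  rewrite /quad_form /contract /B /quad_curv smooth_sumE //; apply: eq_bigr => u _.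
  rewrite smooth_sumE //; apply: eq_bigr => v _; rewrite -mulrA.
  by apply: (evM); [rewrite -HE|apply: (evM)].
have ht X Y xi eta p q u v : represents_field t X xi -> represents_field t Y eta ->
    hess4 d Gam xi eta Ra (e p) (e q) (e u) (e v) (t, x) =
    components4 (nabla2_tensor4 G X Y (curv G)) p q u v x.
  move=> Xxi Yeta; apply/esym.
  apply: (represents_hess4 Jt (GE t Jt) (HE t Jt) (halfE t Jt) Xxi Yeta (RE t Jt));
    by [exact: eE|].
have Qt a b p q : (hess4 d Gam (e a) (e b) Ra (e p) (e ord0) (e q) (e ord0)
    - hess2 d Gam (e a) (e b) (fun X Y => Ra X (e ord0) Y (e ord0)) (e p) (e q))
    (t, x) = Q a b p q.
  apply: (evB); first by apply: ht; exact: eE.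
  apply/esym; apply: (represents_hess2 Jt (GE t Jt) (HE t Jt) (halfE t Jt)
    (eE t Jt a) (eE t Jt b) (rE t Jt)); by [exact: eE|].
apply: (evB); last first.
  by apply: (evD); [apply: (evB); [apply: (evB)|]|]; exact: Qt.
apply: (evB); last first.
  rewrite smooth_sumE //; apply: eq_bigr => p _.
  rewrite smooth_sumE //; apply: eq_bigr => q _.
  apply: (evM); first by rewrite -HE.
  by apply: (evD); [apply: (evD); [apply: (evD)|]|];
    (apply: (evM); [exact: Rmt|exact: rt]).
apply: (evD); last by apply: (evM); [exact: ev2|exact: Bt].
apply: (evB); last by apply: (evM); [exact: ev2|exact: Bt].
apply: (evD); last exact: Bt.
do 2!(apply: (evB); last exact: Bt).
apply: (evD); last exact: Bt.
by apply: ht; exact: NE.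
Qed.
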